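(* Let $k \geqslant 4$, let $d_0 > 2$ be an integer, and let $n = \sum_{i=1}^{k-2}(2^{d_i}-1)$ with positive integers $d_1 > d_2 > \dots > d_{k-3} \geqslant d_{k-2} = d \geqslant d_0$. Put $m = \sum_{i=1}^{k-3}(2^{d_i-d}-1)$. Suppose $\mathcal B \subset \mathsf{PInc}_k^{d_0}$ is compatible with $(k-2)|^{d_0}$. Then the classes in $QP_k$ of the polynomials $$X_{(\mathcal I,\mathcal J)}\,(X_{i,j})^{2^d-2^{d_0}}\,\big(f_{(i,j)}(y)\big)^{2^d},\qquad (\mathcal I,\mathcal J)\in\mathcal B,\ i=\min\mathcal I,\ j = \min\mathcal J,\ y \in B_{k-2}(m),$$ span a subspace of $(QP_k)_n$ containing $\mathrm{Ker}\big((\widetilde{Sq}^0_* )_{(k,n)}\big)$ (i.e. they form a generating set of this kernel). Consequently $\dim \mathrm{Ker}\big((\widetilde{Sq}^0_* )_{(k,n)}\big) \leqslant |\mathcal B|\cdot\dim (QP_{k-2})_m$.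
   Context: $P_k=\mathbb F_2[x_1,\dots,x_k]$ ($\deg x_i=1$) is a module over the mod-2 Steenrod algebra $\mathcal A$; $\mathcal A^+$ is the augmentation ideal; $QP_k = P_k/\mathcal A^+P_k$; $f\equiv g$ means $f+g\in\mathcal A^+P_k$; $(P_k)_n$ and $(QP_k)_n$ denote degree-$n$ parts. Kameko's operation $(\widetilde{Sq}^0_* )_{(k,n)}:(QP_k)_n\to(QP_k)_{(n-k)/2}$ is induced by the linear map sending a monomial $x_1\cdots x_k y^2$ to $y$ and every other monomial to $0$. For $a\ge 0$ let $\alpha_i(a)$ be the $i$-th binary digit of $a$. For a monomial $x = x_1^{a_1}\cdots x_k^{a_k}$, the weight vector is $\omega(x) = (\omega_1(x),\omega_2(x),\dots)$ with $\omega_i(x) = \sum_{j}\alpha_{i-1}(a_j)$, and the exponent vector is $\sigma(x) = (a_1,\dots,a_k)$; both are ordered left-lexicographically. For a weight vector $\omega$, $\deg\omega = \sum_i 2^{i-1}\omega_i$; $P_k^-(\omega)$ is spanned by monomials $y$ with $\deg y=\deg\omega$ and $\omega(y)<\omega$. $(k-2)|^{d}$ denotes the weight vector whose first $d$ entries are $k-2$ and the rest $0$. For monomials of equal degree, $x<y$ means $\omega(x)<\omega(y)$, or $\omega(x)=\omega(y)$ and $\sigma(x)<\sigma(y)$. A monomial $x$ is inadmissible if $x\equiv \sum_j y_j$ for some monomials $y_j<x$, and admissible otherwise. $B_{k-2}(m)$ is the set of admissible monomials of degree $m$ in $P_{k-2}$. $\mathcal A(s-1)$ is the sub-Hopf algebra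 generated by $Sq^i$, $0\le i<2^s$, and $\mathcal A(s-1)^+ = \mathcal A^+\cap\mathcal A(s-1)$. Minimal spike: if $\mu(n)$, the least $r$ with $n = \sum_{i=1}^r(2^{u_i}-1)$, $u_i>0$, equals $s$, then $n=\sum_{i=1}^s(2^{e_i}-1)$ for unique $e_1>\dots>e_{s-1}\ge e_s>0$ and the minimal spike of degree $n$ is $z=\prod_{i=1}^s x_i^{2^{e_i}-1}$. $\mathcal P_{(k,n)}$ is the subspace spanned by monomials $x$ of degree $n$ for which $\sum_{j=1}^h 2^{j-1}\omega_j(x) < \sum_{j=1}^h 2^{j-1}\omega_j(z)$ for some $h\ge1$. $X_{i,j} = \prod_{l\in\{1,\dots,k\}\setminus\{i,j\}}x_l$. $\mathsf{PSeq}_k^{e}$ is the set of pairs $(\mathcal I,\mathcal J)$ of sequences $\mathcal I=(i_1,\dots,i_e)$, $\mathcal J=(j_1,\dots,j_e)$ with $1\le i_t<j_t\le k$; $\mathsf{PInc}_k^e$ is the subset where $i_1\le\dots\le i_e$ and $j_1\le\dots\le j_e$. For such a pair, $X_{(\mathcal I,\mathcal J)} = \prod_{t=1}^e X_{i_t,j_t}^{2^{e-t}}$. For a finite sequence $S=(s_0)|^{c_0}|(s_1)|^{c_1}|\cdots|(s_r)|^{c_r}$ (blocks of $c_i$ equal entries $s_i$, with $s_{i+1}\ne s_i$), the reduced length is $\mathrm{rl}(S) = c_1+\dots+c_r$. A subset $\mathcal B\subset\mathsf{PInc}_k^{d_0}$ ($d_0>2$) is compatible with $(k-2)|^{d_0}$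 if (i) $\mathrm{rl}(\mathcal I)\le d_0-2$ and $\mathrm{rl}(\mathcal J)\le d_0-2$ for all $(\mathcal I,\mathcal J)\in\mathcal B$; and (ii) for every $(\mathcal H,\mathcal K)\in\mathsf{PSeq}_k^{d_0}$ there are subsets $\mathcal B_u\subset\mathcal B$ ($\min\mathcal H<u\le\min\mathcal K$) consisting of pairs $(\mathcal I,\mathcal J)$ with $\min\mathcal I=\min\mathcal H$ and $\min\mathcal J=u$ such that $X_{(\mathcal H,\mathcal K)} + \sum_{u=\min\mathcal H+1}^{\min\mathcal K}\sum_{(\mathcal I,\mathcal J)\in\mathcal B_u}X_{(\mathcal I,\mathcal J)} \in \mathcal A(d_0-1)^+P_k + P_k^-((k-2)|^{d_0}) + \mathcal P_{(k,n_{d_0})}$, where $n_{d_0}=(k-2)(2^{d_0}-1)$. For $1\le i<j\le k$, $f_{(i,j)}:P_{k-2}\to P_k$ is the algebra homomorphism sending $x_1,\dots,x_{k-2}$, in order, to the variables $x_l$, $l\notin\{i,j\}$, in increasing order of $l$. *)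

(* Defs.v *)
From HB Require Import structures.
From mathcomp Require Import all_boot all_order all_algebra.
From mathcomp Require Import mpoly.
From Stdlib Require Import ClassicalEpsilon.

Set Implicit Arguments.
Unset Strict Implicit.
Unset Printing Implicit Defensive.

Import GRing.Theory.
Local Open Scope ring_scope.

(* The polynomial algebra P_k over F_2. Variables x_1..x_k are 'X_0..'X_(k-1). *)
Notation Pk k := {mpoly 'F_2[k]}.

(* homogeneous of degree d (the zero polynomial is homogeneous of every degree) *)
Definition homogn k (d : nat) (p : Pk k) : bool :=
  all (fun m : 'X_{1..k} => mdeg m == d) (msupp p).

Definition SqMon k (i : nat) (m : 'X_{1..k}) : Pk k :=
  \sum_(t : {ffun 'I_k -> 'I_i.+1} | (\sum_(j < k) (t j : nat))%N == i)
     ((\prod_(j < k) 'C(m j, t j))%N%:R *: 'X_[[multinom (m j + t j)%N | j < k]]).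

Definition Sq k (i : nat) (p : Pk k) : Pk k :=
  \sum_(m <- msupp p) p@_m *: SqMon i m.

Definition hit k (f : Pk k) : Prop :=
  exists l : seq (nat * Pk k),
    (forall x, x \in l -> (0 < x.1)%N) /\ f = \sum_(x <- l) Sq x.1 x.2.

(* A(s-1)^+ P_k : the sum of the images of Sq^i, 0 < i < 2^s *)
Definition hitA k (s : nat) (f : Pk k) : Prop :=
  exists l : seq (nat * Pk k),
    (forall x, x \in l -> (0 < x.1 < 2 ^ s)%N) /\ f = \sum_(x <- l) Sq x.1 x.2.

Definition kameko k (p : Pk k) : Pk k :=
  \sum_(m <- msupp p | [forall j : 'I_k, odd (m j)])
     p@_m *: 'X_[[multinom (m j)./2 | j < k]].

(* omega m i = omega_{i+1}(x^m) = sum_j alpha_i(a_j) *)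
Definition omega k (m : 'X_{1..k}) (i : nat) : nat :=
  (\sum_(j < k) (odd (m j %/ 2 ^ i) : nat))%N.

Definition wlt (w1 w2 : nat -> nat) : Prop :=
  exists i, (forall j, (j < i)%N -> w1 j = w2 j) /\ (w1 i < w2 i)%N.

Definition slt k (m1 m2 : 'X_{1..k}) : Prop :=
  exists i : 'I_k, (forall j : 'I_k, (j < i)%N -> m1 j = m2 j) /\ (m1 i < m2 i)%N.

Definition mlt k (x y : 'X_{1..k}) : Prop :=
  mdeg x = mdeg y /\
  (wlt (omega x) (omega y) \/ ((forall i, omega x i = omega y i) /\ slt x y)).

Definition inadmissible k (x : 'X_{1..k}) : Prop :=
  exists q : Pk k, (forall y, y \in msupp q -> mlt y x) /\ hit ('X_[x] + q).

Definition admissible k (x : 'X_{1..k}) : Prop := ~ inadmissible x.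

(* the weight vector is given by the finite list w: omega_{i+1} = nth 0 w i *)
Definition wdeg (w : seq nat) : nat := (\sum_(i < size w) 2 ^ i * nth 0 w i)%N.

Definition Pminus k (w : seq nat) (p : Pk k) : Prop :=
  forall y, y \in msupp p -> mdeg y = wdeg w /\ wlt (omega y) (fun i => nth 0 w i).

Definition spike_sum (n r : nat) : Prop :=
  exists s : seq nat, size s = r /\ (forall u, u \in s -> (0 < u)%N) /\
                      sumn [seq (2 ^ u - 1)%N | u <- s] = n.

Definition min_spike_exps (n : nat) (e : seq nat) : Prop :=
  [/\ (forall u, u \in e -> (0 < u)%N),
      sumn [seq (2 ^ u - 1)%N | u <- e] = n,
      (forall r, (r < size e)%N -> ~ spike_sum n r),
      (forall i, (i.+2 < size e)%N -> (nth 0 e i.+1 < nth 0 e i)%N) &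
      (forall i, (i.+1 < size e)%N -> (nth 0 e i.+1 <= nth 0 e i)%N)].

(* omega_{j+1} of the spike prod x_i^{2^{e_i}-1} is #{i | j < e_i} *)
Definition Pkn k (n : nat) (p : Pk k) : Prop :=
  forall x, x \in msupp p ->
    mdeg x = n /\
    exists e, min_spike_exps n e /\
      exists h, (0 < h)%N /\
        (\sum_(j < h) 2 ^ j * omega x j < \sum_(j < h) 2 ^ j * count (fun u => j < u)%N e)%N.

Definition pairT k d := (d.-tuple 'I_k * d.-tuple 'I_k)%type.

Definition inPSeq k d (p : pairT k d) : bool :=
  [forall t : 'I_d, (tnth p.1 t < tnth p.2 t)%N].

Definition inPInc k d (p : pairT k d) : bool :=
  [&& inPSeq p, sorted leq (map val p.1) & sorted leq (map val p.2)].

Definition smin (s : seq nat) : nat := foldr minn (head 0%N s) s.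
Definition tmin k d (t : d.-tuple 'I_k) : nat := smin (map val t).

(* reduced length: length minus the length of the first block *)
Definition rl (s : seq nat) : nat := (size s - find (fun x => x != head 0%N s) s)%N.

Definition Xij k (i j : nat) : Pk k :=
  \prod_(l < k | (l != i :> nat) && (l != j :> nat)) 'X_l.

Definition XIJ k d (p : pairT k d) : Pk k :=
  \prod_(t < d) Xij k (tnth p.1 t) (tnth p.2 t) ^+ (2 ^ (d - t.+1)).

Definition fij k (i j : nat) (y : Pk (k - 2)) : Pk k :=
  comp_mpoly
    [tuple nth 0 [seq ('X_l : Pk k) | l <- enum [pred l : 'I_k | (l != i :> nat) && (l != j :> nat)]] t
    | t < k - 2] y.

Definition inRel k d0 (f : Pk k) : Prop :=
  exists a b c : Pk k, f = a + b + c /\ hitA d0 a /\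
    Pminus (nseq d0 (k - 2)%N) b /\ Pkn ((k - 2) * (2 ^ d0 - 1))%N c.

Definition compatible k d0 (B : {set pairT k d0}) : Prop :=
  (forall p, p \in B -> (rl (map val p.1) <= d0 - 2)%N /\ (rl (map val p.2) <= d0 - 2)%N) /\
  (forall HK : pairT k d0, inPSeq HK ->
     exists Bu : nat -> {set pairT k d0},
       (forall u, Bu u \subset B) /\
       (forall u p, p \in Bu u -> tmin p.1 = tmin HK.1 /\ tmin p.2 = u) /\
       inRel d0 (XIJ HK + \sum_((tmin HK.1).+1 <= u < (tmin HK.2).+1)
                              \sum_(p in Bu u) XIJ p)).

Definition gen k d0 d (p : pairT k d0) (y : 'X_{1..k - 2}) : Pk k :=
  let i := tmin p.1 in let j := tmin p.2 in
  XIJ p * Xij k i j ^+ (2 ^ d - 2 ^ d0) * (fij (k:=k) i j 'X_[y]) ^+ (2 ^ d).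

(* the image of V in QP_k is contained in the span of the classes of N polynomials *)
Definition spanN k (V : Pk k -> Prop) (N : nat) : Prop :=
  exists s : seq (Pk k), size s = N /\
    forall f, V f -> exists b : bitseq, hit (f + \sum_(g <- mask b s) g).

Definition decP (P : Prop) : bool := if excluded_middle_informative P then true else false.

Lemma decPP (P : Prop) : reflect P (decP P).
Proof. by rewrite /decP; case: excluded_middle_informative => h; constructor. Qed.

Lemma spanN_ex k (V : Pk k -> Prop) :
  (exists N, spanN V N) -> exists N, decP (spanN V N).
Proof. by case=> N h; exists N; apply/decPP. Qed.

(* dimension of the image of V in QP_k = least size of a spanning family
   (the second branch never occurs: these spaces are finite dimensional) *)
Definition qdim k (V : Pk k -> Prop) : nat :=
  match excluded_middle_informative (exists N, spanN V N) with
  | left h => ex_minn (spanN_ex h)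
  | right _ => 0%N
  end.

(* Ker (Sq0~)_(k,n) as a preimage in (P_k)_n *)
Definition kerKameko k n (f : Pk k) : Prop := homogn n f /\ hit (kameko f).

(* Main.v *)
Require Import Defs.
From HB Require Import structures.
From mathcomp Require Import all_boot all_order all_algebra.
From mathcomp Require Import mpoly zify ring.
From Stdlib Require Import ClassicalEpsilon.

Set Implicit Arguments.
Unset Strict Implicit.
Unset Printing Implicit Defensive.

Import GRing.Theory.
Local Open Scope ring_scope.

(* Write [s = k - 2] and [M0 = sum_i 2 ^ (d_i - d)].  The degrees
   [2 ^ e * M0 - s], for [e = 0, ..., d], run from [m] to [n], and by a count of
   binary digits none of them is a sum of fewer than [s] numbers [2 ^ u - 1].
   The conjugation trick [u Sq^a(v) = chi(Sq^a)(u) v] modulo hits, where [u] is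
   a product of variables and [chi(Sq)] maps [x] to [x + x^2 + x^4 + ...], then
   shows in these degrees that [Y g^2] is hit when [Y] is a product of fewer
   than [s] distinct variables, and that [X_(i,j) v^2] only depends on the
   class of [v].  Hence the kernel of Kameko's operation is spanned by the
   towers [X_(H,K) y^(2^d)].

   The part of the compatibility relations in [P_(k,n)] needs a criterion of
   Silverman type.  If all [k] variables occur to an odd power, the trick gives
   [x_1 ... x_k (Sq^a g)^2 = sum_(i < j) X_(i,j) (x_i x_j Sq^(a-1) g)^2] modulo
   hits, so one carries along a presentation [v = sum Sq^a g] for which every
   [x_i x_j sum Sq^(a-1) g] is again hit.

   Finally a relation applied to [d0] consecutive entries of [(H,K)] never
   increases the two minima [i] and [j], and since the first two entries of a
   member of [B] are both [(i,j)], sliding the window makes all upper entries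
   equal to [(i,j)].  If [x_i] divides [y], the relation [Sq^1] replaces one
   factor [x_i] of [y] and the first entry [(i,j)] by [x_l] and [(l,j)]; the
   second entry keeps the minima from increasing, so this terminates. *)

(** * Binary digit sums *)

Fixpoint alpha_rec (f n : nat) : nat :=
  if f is f'.+1 then (odd n + alpha_rec f' n./2)%N else 0%N.

(** The number of binary digits 1; [n] is enough fuel, since every step halves the argument. *)
Definition alpha (n : nat) : nat := alpha_rec n n.
Arguments alpha : simpl never.

Lemma alpha_recE f n : (n <= f)%N -> alpha_rec f n = alpha n.
Proof.
rewrite /alpha; elim/ltn_ind: n f => n IH [|f] nf; first by case: n nf {IH}.
case: n IH nf => [|n] IH nf.
  by elim: f {nf IH} => [|f] //=; rewrite !add0n.
rewrite [LHS]/= [RHS]/=; congr addn.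
by rewrite (IH (uphalf n)) ?(IH (uphalf n) _ n) //; lia.
Qed.

Lemma alphaE n : alpha n = (odd n + alpha n./2)%N.
Proof.
case: n => [|n] //.
by rewrite /alpha [LHS]/=; congr addn; rewrite alpha_recE //; lia.
Qed.

Lemma alpha_double n : alpha (2 * n) = alpha n.
Proof. by rewrite alphaE mul2n odd_double half_double. Qed.

Lemma alpha_doubleS n : alpha (2 * n).+1 = (alpha n).+1.
Proof. by rewrite alphaE mul2n /= odd_double /= uphalf_double add1n. Qed.

(** A carry only merges two digits into one. If both numbers are odd, the carry is split off as a
    summand 1 and handled by a second use of the induction hypothesis. *)
Lemma alpha_leD a b : (alpha (a + b) <= alpha a + alpha b)%N.
Proof.
have [n le_n] := ubnP (a + b); elim: n a b le_n => // n IH a b le_n.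
have [->|a0] := posnP a; first by rewrite add0n leq_addl.
have [->|b0] := posnP b; first by rewrite addn0 leq_addr.
have H1 : (alpha (a./2 + b./2) <= alpha a./2 + alpha b./2)%N by apply: IH; lia.
rewrite (alphaE (a + b)) (alphaE a) (alphaE b).
have [ab|ab] := boolP (odd a && odd b); last first.
  have -> : ((a + b)./2 = a./2 + b./2)%N by lia.
  by lia.
have H2 : (alpha (1 + (a./2 + b./2)) <= alpha 1 + alpha (a./2 + b./2))%N.
  by apply: IH; lia.
have a1 : alpha 1 = 1%N by [].
have -> : ((a + b)./2 = 1 + (a./2 + b./2))%N by lia.
by move: H2; rewrite a1; lia.
Qed.

Lemma alpha_le n : (alpha n <= n)%N.
Proof.
elim/ltn_ind: n => n IH; rewrite alphaE; have [->//|n0] := posnP n.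
by have := IH n./2 ltac:(lia); lia.
Qed.

Lemma alpha_lt n : (1 < n)%N -> (alpha n < n)%N.
Proof. by move=> n1; rewrite alphaE; have := alpha_le n./2; lia. Qed.

Lemma alpha_exp2D e n : (n < 2 ^ e)%N -> alpha (2 ^ e + n) = (alpha n).+1.
Proof.
elim: e n => [|e IH] n; first by case: n.
rewrite expnS => lt_n; rewrite (alphaE (_ + n)) (alphaE n).
have -> : ((2 * 2 ^ e + n)./2 = 2 ^ e + n./2)%N by lia.
by rewrite IH ?oddD ?oddM /= ?addnS //; lia.
Qed.

Lemma alpha_exp2 e : alpha (2 ^ e) = 1%N.
Proof. by rewrite -[X in alpha X]addn0 alpha_exp2D ?expn_gt0. Qed.

(* The property of the top degree [M0 - s] from which every non-vanishing
   estimate below is deduced: it says that [M0 - s] is not a sum of fewer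
   than [s] numbers of the form [2 ^ u - 1], in a form stable under halving. *)
Definition spike_base (s M0 : nat) : Prop :=
  forall q, (0 < q <= M0)%N -> (s <= alpha (M0 - q) + alpha q.-1 + 1)%N.

(** Halving loses exactly one digit in total: for odd [q] it is the last digit of the difference,
    for even [q] the last digit of [q - 1]. So each doubling of the degree improves the bound by
    one. *)
Lemma spike_base_lift s M0 e q : spike_base s M0 -> (0 < q <= 2 ^ e * M0)%N ->
  (s + e <= alpha (2 ^ e * M0 - q) + alpha q.-1 + 1)%N.
Proof.
move=> base; elim: e q => [|e IH] q; first by rewrite mul1n addn0; exact: base.
rewrite expnS -mulnA; set N := (2 ^ e * M0)%N in IH * => lt_q.
case oq : (odd q).
  have Hq : q = (2 * (q./2)).+1 by lia.
  have H := IH (q./2).+1 ltac:(lia).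
  have -> : (2 * N - q = (2 * (N - (q./2).+1)).+1)%N by lia.
  rewrite {2}Hq [(_.+1).-1]/= alpha_double alpha_doubleS.
  by move: H => /=; lia.
have H := IH q./2 ltac:(lia).
have -> : (2 * N - q = 2 * (N - q./2))%N by lia.
have -> : q.-1 = (2 * (q./2).-1).+1 by lia.
by rewrite alpha_double alpha_doubleS; lia.
Qed.

(** As [(M - q) + (q - 1) = M - 1], subadditivity of digit sums reduces the claim to [M - 1] having
    at least [s - 1] digits 1. *)
Lemma spike_baseP (s : nat) (e : nat -> nat) : (1 < s)%N ->
  (forall i, (1 <= i)%N -> (i < s.-1)%N -> (e i.+1 < e i)%N) ->
  (e s <= e s.-1)%N -> spike_base s (\sum_(1 <= i < s.+1) 2 ^ e i).
Proof.
move=> s1 dec decs q /andP[q0 qM].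
set M := (\sum_(1 <= i < s.+1) _)%N.
suff H : (s.-1 <= alpha M.-1)%N.
  have := alpha_leD (M - q) q.-1.
  have -> : (M - q + q.-1 = M.-1)%N by lia.
  by lia.
(* Induction over the [j + 1] last powers. Their sum is at most twice the largest of them, and for
   [j = 0] at most that power itself, which is why the last two exponents may coincide. Hence the
   next power is added to the sum minus one without a carry. *)
have {q q0 qM} : forall j, (j < s)%N ->
    (j <= alpha (\sum_(s - j <= i < s.+1) 2 ^ e i).-1)%N /\
    (\sum_(s - j <= i < s.+1) 2 ^ e i <= 2 ^ (e (s - j)%N + (0 < j)))%N.
  elim=> [|j IH] js; first by rewrite subn0 big_nat1 addn0.
  have {IH}[IH1 IH2] := IH (ltnW js).
  have -> : (s - j.+1 = (s - j).-1)%N by lia.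
  rewrite big_ltn; last by lia.
  have -> : ((s - j).-1.+1 = s - j)%N by lia.
  move: IH1 IH2; set S := (\sum_(s - j <= i < s.+1) 2 ^ e i)%N => IH1 IH2.
  have S0 : (0 < S)%N.
    rewrite /S big_ltn; last by lia.
    by rewrite addn_gt0 expn_gt0.
  have le_S : (S <= 2 ^ e (s - j).-1)%N.
    apply: leq_trans IH2 _; rewrite leq_exp2l //.
    case: j js {IH1 S0 S} => [|j] js; first by rewrite subn0 addn0.
    rewrite addn1; have := dec (s - j.+1).-1.
    have -> : ((s - j.+1).-1.+1 = s - j.+1)%N by lia.
    by apply; lia.
  split; last by rewrite addn1 expnS mul2n -addnn leq_add2l.
  have -> : ((2 ^ e (s - j).-1 + S).-1 = 2 ^ e (s - j).-1 + S.-1)%N by lia.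
  by rewrite alpha_exp2D //; lia.
case/(_ s.-1 ltac:(lia)) => + _.
by have -> : (s - s.-1 = 1)%N by lia.
Qed.

(** * Polynomials over the field with two elements *)

Section Char2.
Variable k : nat.
Implicit Types p q : Pk k.

Lemma pchar_Pk : 2%N \in [pchar (Pk k)].
Proof. exact: (rmorph_pchar (@mpolyC k 'F_2) (pchar_Fp (isT : prime 2))). Qed.

Lemma pchar_polyPk : 2%N \in [pchar {poly Pk k}].
Proof. exact: (rmorph_pchar (@polyC (Pk k)) pchar_Pk). Qed.

Lemma addpp p : p + p = 0. Proof. exact: addrr_pchar2 pchar_Pk p. Qed.

Lemma addppK p q : p + q + q = p. Proof. by rewrite -addrA addpp addr0. Qed.

Lemma expp2D p q : (p + q) ^+ 2 = p ^+ 2 + q ^+ 2.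
Proof. by have := pFrobenius_autD_comm pchar_Pk (mulrC p q). Qed.

Lemma expp2XnD e p q : (p + q) ^+ (2 ^ e) = p ^+ (2 ^ e) + q ^+ (2 ^ e).
Proof.
elim: e => [|e IH]; first by rewrite !expr1.
by rewrite expnS mulnC !exprM IH expp2D.
Qed.

Lemma expp2Xn_sum e (I : Type) (r : seq I) (P : pred I) (F : I -> Pk k) :
  (\sum_(i <- r | P i) F i) ^+ (2 ^ e) = \sum_(i <- r | P i) F i ^+ (2 ^ e).
Proof.
apply: (big_morph (fun p => p ^+ (2 ^ e))); first exact: expp2XnD.
by rewrite expr0n expn_eq0.
Qed.

Lemma expp2_sum (I : Type) (r : seq I) (P : pred I) (F : I -> Pk k) :
  (\sum_(i <- r | P i) F i) ^+ 2 = \sum_(i <- r | P i) F i ^+ 2.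
Proof. exact: (@expp2Xn_sum 1). Qed.

Lemma F2_neq0 (c : 'F_2) : c != 0 -> c = 1.
Proof. by case: c => -[|[|]] // i _; apply/val_inj. Qed.

Lemma mpolyE_F2 p : p = \sum_(m <- msupp p) 'X_[m].
Proof.
rewrite {1}[p]mpolyE; apply: eq_big_seq => m.
by rewrite mcoeff_msupp => /F2_neq0 ->; rewrite scale1r.
Qed.

Lemma mpoly_ind_supp (P : Pk k -> Prop) p :
  P 0 -> (forall q r, P q -> P r -> P (q + r)) ->
  (forall m, m \in msupp p -> P 'X_[m]) -> P p.
Proof.
move=> P0 PD PX; rewrite [p]mpolyE_F2 big_seq.
by apply: (big_ind P) => // m; apply: PX.
Qed.

End Char2.

(** * Steenrod squares as coefficients of the total square *)

Section PolyCoef.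
Variable R : comNzRingType.

Lemma coefM_trunc (a b c d : {poly R}) i :
  (forall j, (j <= i)%N -> a`_j = c`_j) -> (forall j, (j <= i)%N -> b`_j = d`_j) ->
  forall j, (j <= i)%N -> (a * b)`_j = (c * d)`_j.
Proof.
move=> ac bd j ji; rewrite !coefM; apply: eq_bigr => l _.
by rewrite ac ?bd //; have := ltn_ord l; lia.
Qed.

(** Truncating each factor at degree [i] does not change the coefficient, and the truncated product
    can be distributed. The resulting index set is the one in [SqMon]. *)
Lemma coef_prod_sum (I : finType) (a : I -> {poly R}) i :
  (\prod_j a j)`_i =
  \sum_(t : {ffun I -> 'I_i.+1} | (\sum_j (t j : nat))%N == i) \prod_j (a j)`_(t j).
Proof.
pose b j := \sum_(t < i.+1) (a j)`_t *: 'X^t.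
have -> : (\prod_j a j)`_i = (\prod_j b j)`_i.
  suff: forall l, (l <= i)%N -> (\prod_j a j)`_l = (\prod_j b j)`_l by apply.
  apply: (big_ind2 (fun p q : {poly R} => forall l, (l <= i)%N -> p`_l = q`_l)) => //.
    by move=> p q r s pq rs l; apply: coefM_trunc.
  move=> j _ l li; rewrite /b coef_sum (bigD1 (Ordinal (li : (l < i.+1)%N))) //=.
  rewrite coefZ coefXn eqxx mulr1 big1 ?addr0 // => t /eqP tl.
  rewrite coefZ coefXn; case: eqP => [e|]; last by rewrite mulr0.
  by case: tl; apply/val_inj.
rewrite /b bigA_distr_bigA coef_sum [RHS]big_mkcond; apply: eq_bigr => t _.
have -> : \prod_j ((a j)`_(t j) *: 'X^(t j)) =
          (\prod_j (a j)`_(t j)) *: 'X^(\sum_j t j).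
  rewrite scaler_prod; congr (_ *: _).
  by rewrite (big_morph _ (fun n m => exprD 'X n m) (expr0 'X)).
rewrite coefZ coefXn eq_sym; case: eqP; by rewrite ?mulr1 ?mulr0.
Qed.

End PolyCoef.

Section TotalSquare.
Variable k : nat.
Implicit Types (p q : Pk k) (m : 'X_{1..k}).

Definition Stvar (i : 'I_k) : {poly Pk k} := ('X_i)%:P + ('X_i ^+ 2) *: 'X.

(** The total square, with the indeterminate recording the degree of each square. As a ring morphism
    it turns the Cartan formula into multiplicativity. *)
Definition St : Pk k -> {poly Pk k} := mmap (polyC \o @mpolyC k 'F_2) Stvar.

HB.instance Definition _ := GRing.RMorphism.on St.

Lemma StX i : St 'X_i = Stvar i.
Proof. by rewrite /St mmapX mmap1U. Qed.

Lemma coef_Stvar_exp i e t :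
  (Stvar i ^+ e)`_t = ('C(e, t))%:R *: 'X_i ^+ (e + t).
Proof.
rewrite /Stvar exprDn coef_sum.
have E (j : 'I_e.+1) : ((('X_i)%:P ^+ (e - j) * ('X_i ^+ 2 *: 'X) ^+ j *+ 'C(e, j)) : {poly Pk k})`_t
    = if t == j then ('C(e, t))%:R *: 'X_i ^+ (e + t) else 0.
  rewrite coefMn -rmorphXn coefCM exprZn coefZ coefXn.
  case: eqP => [->|_]; last by rewrite !mulr0 mul0rn.
  rewrite mulr1 -exprM -exprD scaler_nat; congr (_ ^+ _ *+ _).
  by have := ltn_ord j; lia.
rewrite (eq_bigr _ (fun j _ => E j)); have [te|te] := ltnP t e.+1.
  rewrite (bigD1 (Ordinal te)) //= eqxx big1 ?addr0 // => j /eqP jt.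
  by case: eqP => // e'; case: jt; apply/val_inj.
rewrite big1 ?bin_small ?scale0r // => j _.
by case: eqP => // tj; move: te; rewrite tj leqNgt ltn_ord.
Qed.

Lemma SqMonE i m : SqMon i m = (St 'X_[m])`_i.
Proof.
rewrite /SqMon /St mmapX /mmap1 coef_prod_sum; apply: eq_bigr => t _.
rewrite mpolyXE_id natr_prod -scaler_prod; apply: eq_bigr => j _.
by rewrite coef_Stvar_exp mnmE.
Qed.

Lemma StD p q : St (p + q) = St p + St q.
Proof. exact: rmorphD. Qed.

Lemma StZ c p : St (c *: p) = (c%:MP)%:P * St p.
Proof. exact: mmapZ. Qed.

Lemma SqE i p : Sq i p = (St p)`_i.
Proof.
rewrite [in RHS](mpolyE p) raddf_sum coef_sum /Sq; apply: eq_bigr => m _.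
by rewrite SqMonE [X in _ = X]/= StZ coefCM mul_mpolyC.
Qed.

Lemma SqD i p q : Sq i (p + q) = Sq i p + Sq i q.
Proof. by rewrite !SqE raddfD coefD. Qed.

Lemma Sq0 i : Sq i 0 = 0 :> Pk k.
Proof. by rewrite SqE raddf0 coef0. Qed.

Lemma Sq_sum i (I : Type) (r : seq I) (P : pred I) (F : I -> Pk k) :
  Sq i (\sum_(j <- r | P j) F j) = \sum_(j <- r | P j) Sq i (F j).
Proof. exact: (big_morph _ (SqD i) (Sq0 i)). Qed.

Lemma SqM i p q : Sq i (p * q) = \sum_(j < i.+1) Sq j p * Sq (i - j) q.
Proof. by rewrite SqE rmorphM coefM; apply: eq_bigr => j _; rewrite !SqE. Qed.

Lemma coef_polyX2 (a : {poly Pk k}) i :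
  (a ^+ 2)`_i = if odd i then 0 else a`_i./2 ^+ 2.
Proof.
have -> : a ^+ 2 = \sum_(j < size a) a`_j ^+ 2 *: 'X^(2 * j).
  rewrite -{1}[a]coefK poly_def.
  rewrite (big_morph (fun p : {poly Pk k} => p ^+ 2) (id1 := 0) (op1 := +%R)) ?expr0n //.
    by apply: eq_bigr => j _; rewrite exprZn -exprM mulnC.
  by move=> x y; have := pFrobenius_autD_comm (pchar_polyPk k) (mulrC x y).
rewrite coef_sum; case oi : (odd i).
  rewrite big1 // => j _; rewrite coefZ coefXn.
  by case: eqP => [e|]; rewrite ?mulr0 //; move: oi; rewrite e mul2n odd_double.
have [ia|ia] := ltnP i./2 (size a).
  rewrite (bigD1 (Ordinal ia)) //= coefZ coefXn (_ : i == _) ?mulr1; last by apply/eqP; lia.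
  rewrite big1 ?addr0 // => j /eqP jt; rewrite coefZ coefXn.
  by case: eqP => [e|]; rewrite ?mulr0 //; case: jt; apply/val_inj => /=; lia.
rewrite big1 ?(nth_default _ ia) ?expr0n // => j _; rewrite coefZ coefXn.
by case: eqP => [e|]; rewrite ?mulr0 //; move: ia (ltn_ord j); rewrite e; lia.
Qed.

Lemma Sq_square i p : Sq i (p ^+ 2) = if odd i then 0 else Sq i./2 p ^+ 2.
Proof. by rewrite !SqE rmorphXn coef_polyX2. Qed.

Lemma Sq_expr2n s i p : (0 < i < 2 ^ s)%N -> Sq i (p ^+ (2 ^ s)) = 0.
Proof.
elim: s i => [|s IH] i; first by case: i => [|[]].
rewrite expnSr exprM Sq_square; case oi : (odd i) => // lt_i.
by rewrite IH ?expr0n //; lia.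
Qed.

Lemma Sq_0 p : Sq 0 p = p.
Proof.
have SX m : Sq 0 'X_[m] = 'X_[m] :> Pk k.
  rewrite SqE /St mmapX /mmap1 -horner_coef0 mpolyXE_id.
  rewrite (big_morph (fun p : {poly Pk k} => p.[0]) (id1 := 1) (op1 := *%R)).
  - by apply: eq_bigr => i _; rewrite horner_exp /Stvar !hornerE ?mulr0 ?addr0.
  - by move=> a b; rewrite hornerM.
  - by rewrite hornerC.
rewrite {1}[p]mpolyE_F2 Sq_sum [RHS]mpolyE_F2; exact: eq_bigr.
Qed.

(** All positive squares below [2 ^ s] vanish on a [2 ^ s]-th power, so only one term of the Cartan
    formula survives. This makes relations modulo [hitA] stable under multiplication by such
    powers. *)
Lemma Sq_mulr_expr2n s i p q : (i < 2 ^ s)%N ->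
  Sq i (p * q ^+ (2 ^ s)) = Sq i p * q ^+ (2 ^ s).
Proof.
move=> lt_i; rewrite SqM big_ord_recr /= subnn Sq_0 big1 ?add0r // => j _.
by rewrite Sq_expr2n ?mulr0 //; have := ltn_ord j; lia.
Qed.

Lemma dhomog_SqMon i m : SqMon i m \is (mdeg m + i).-homog.
Proof.
rewrite /SqMon; apply: rpred_sum => t /eqP ti; apply: rpredZ.
have -> : (mdeg m + i = mdeg m + \sum_j (t j : nat))%N by rewrite ti.
rewrite dhomogX !mdegE -big_split /=; apply/eqP.
by rewrite mdegE; apply: eq_bigr => j _; rewrite mnmE.
Qed.

Lemma dhomog_Sq i d p : p \is d.-homog -> Sq i p \is (d + i).-homog.
Proof.
move=> /dhomogP hp; rewrite /Sq big_seq; apply: rpred_sum => m /hp <-.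
by apply: rpredZ; apply: dhomog_SqMon.
Qed.

Lemma Sq_deg d p : p \is d.-homog -> Sq d p = p ^+ 2.
Proof.
have SX m : Sq (mdeg m) 'X_[m] = 'X_[m] ^+ 2 :> Pk k.
  rewrite SqE /St mmapX /mmap1 mpolyXE_id -prodrXl mdegE.
  (* The size bound is carried along because it leaves the product of the two top coefficients as
     the only contribution to the top coefficient. *)
  have E : forall r : seq 'I_k, (size (\prod_(i <- r) Stvar i ^+ m i)%R <= (\sum_(i <- r) m i).+1)%N
     /\ (\prod_(i <- r) Stvar i ^+ m i)`_(\sum_(i <- r) m i)%N = \prod_(i <- r) ('X_i ^+ m i) ^+ 2.
    elim=> [|i r [IH1 IH2]]; first by rewrite !big_nil size_poly1 coef1.
    rewrite !big_cons.
    have S1 : (size (Stvar i ^+ m i)%R <= (m i).+1)%N.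
      apply/leq_sizeP => j ij; rewrite coef_Stvar_exp bin_small ?scale0r //.
    split.
      by apply: leq_trans (size_polyMleq _ _) _; lia.
    have H : (m i + \sum_(j <- r) m j < (m i + \sum_(j <- r) m j).+1)%N by [].
    have Hm : (m i < (m i + \sum_(j <- r) m j).+1)%N by lia.
    rewrite coefM (bigD1 (Ordinal Hm)) //=.
    rewrite addKn IH2 coef_Stvar_exp binn scale1r addnn -muln2 exprM [X in _ + X]big1 ?addr0 // => j /eqP jm.
    case: (ltngtP j (m i)) => [lt|gt|e]; last by case: jm; apply/val_inj.
      by rewrite [X in _ * X](leq_sizeP _ _ IH1) ?mulr0 //; lia.
    by rewrite [X in X * _](leq_sizeP _ _ S1) ?mul0r //; lia.
  by case: (E (index_enum _)).
move=> /dhomogP hp; rewrite {1}[p]mpolyE_F2 Sq_sum {2}[p]mpolyE_F2 expp2_sum.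
by apply: eq_big_seq => m /hp <-; apply: SX.
Qed.

Lemma Sq_var (i : 'I_k) j : Sq j ('X_i : Pk k) =
  if j == 0%N then 'X_i else if j == 1%N then 'X_i ^+ 2 else 0.
Proof.
rewrite SqE StX /Stvar coefD coefC coefZ coefX.
by case: j => [|[|j]] /=; rewrite ?mulr0 ?addr0 ?mulr1 ?add0r.
Qed.

End TotalSquare.

(** * The conjugation trick *)

Section ChiTrick.
Variable k : nat.
Implicit Types (p q v : Pk k) (r : seq 'I_k) (S J : {set 'I_k}).

Definition Uvar n (i : 'I_k) : {poly Pk k} :=
  \sum_(j < n.+1) 'X_i ^+ (2 ^ j) *: 'X^(2 ^ j - 1).

(* On a product of variables, the conjugate [chi (Sq^b)] of [Sq^b]: the total
   conjugate square maps [x] to the sum of the [x ^ (2 ^ j)], here truncated at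
   [j = n], which does not affect the degrees [b < 2 ^ n] that matter. *)
Definition chi n b r : Pk k := (\prod_(i <- r) Uvar n i)`_b.

Definition vprod r : Pk k := \prod_(i <- r) 'X_i.

Lemma coef_Uvar n i j : (Uvar n i)`_j = 0 \/
  exists e, j.+1 = (2 ^ e)%N /\ (Uvar n i)`_j = 'X_i ^+ j.+1.
Proof.
have pow (e : nat) : ((2 ^ e - 1).+1 = 2 ^ e)%N by have := expn_gt0 2 e; lia.
rewrite /Uvar coef_sum.
have [/existsP[e /eqP je]|N] := boolP [exists e : 'I_n.+1, j == (2 ^ e - 1)%N].
  right; exists e; split; first by rewrite je pow.
  rewrite (bigD1 e) //= coefZ coefXn je eqxx mulr1 pow big1 ?addr0 // => f /eqP fe.
  rewrite coefZ coefXn; case: eqP => [E|]; last by rewrite mulr0.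
  case: fe; apply/val_inj/eqP; rewrite -(eqn_exp2l (m := 2)) //.
  by apply/eqP; rewrite -(pow e) -(pow f) E.
left; rewrite big1 // => e _; rewrite coefZ coefXn.
case: eqP => [E|]; last by rewrite mulr0.
by case/existsP: N; exists e; apply/eqP.
Qed.

Lemma expr2_polyD (a b : {poly Pk k}) : (a + b) ^+ 2 = a ^+ 2 + b ^+ 2.
Proof. by have := pFrobenius_autD_comm (pchar_polyPk k) (mulrC a b). Qed.

(** Squaring shifts the powers [x ^ (2 ^ j)] by one, so everything beyond the linear term is the
    indeterminate times a square. *)
Lemma UvarS n i : Uvar n.+1 i = ('X_i)%:P + 'X * Uvar n i ^+ 2.
Proof.
rewrite {1}/Uvar big_ord_recl expn0 subnn expr0 expr1 alg_polyC; congr (_ + _).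
rewrite /Uvar (big_morph (fun p : {poly Pk k} => p ^+ 2) (id1 := 0) (op1 := +%R)) ?expr0n //;
  last exact: expr2_polyD.
rewrite mulr_sumr; apply: eq_bigr => j _; rewrite lift0.
rewrite exprZn -exprM -scalerAr -exprM -exprS expnSr; congr (_ *: 'X^_).
by have := expn_gt0 2 j; lia.
Qed.

(** The total square extended to polynomials in the indeterminate by fixing the latter: evaluating
    the outer indeterminate at the inner one adds the two degrees. *)
Definition Shat (a : {poly Pk k}) : {poly Pk k} := (map_poly (@St k) a).['X].

Lemma ShatM a b : Shat (a * b) = Shat a * Shat b.
Proof. by rewrite /Shat rmorphM hornerM. Qed.

Lemma ShatD a b : Shat (a + b) = Shat a + Shat b.
Proof. by rewrite /Shat rmorphD hornerD. Qed.

Lemma ShatC p : Shat p%:P = St p.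
Proof. by rewrite /Shat map_polyC hornerC. Qed.

Lemma ShatXn n : Shat 'X^n = 'X^n.
Proof. by rewrite /Shat map_polyXn hornerXn. Qed.

Lemma coef_Shat a m : (Shat a)`_m = \sum_(b < m.+1) Sq (m - b) a`_b.
Proof.
rewrite /Shat (@horner_coef_wide _ (size a + m.+1)); last first.
  by apply: leq_trans (size_poly _ _) (leq_addr _ _).
rewrite coef_sum.
rewrite (big_ord_widen (size a + m.+1) (fun b => Sq (m - b) a`_b)) ?leq_addl //.
rewrite [RHS]big_mkcond; apply: eq_bigr => b _; rewrite coefMXn ltnS.
by case: ltnP => // _; rewrite SqE coef_map.
Qed.

(** Each term is sent to the sum of itself and its successor, so the sum telescopes in
    characteristic 2. Up to the truncation error, [Uvar] is thus inverse to the total square. *)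
Lemma Shat_Uvar n i :
  Shat (Uvar n i) = ('X_i)%:P + 'X_i ^+ (2 ^ n.+1) *: 'X^(2 ^ n.+1 - 1).
Proof.
pose T j : {poly Pk k} := 'X_i ^+ (2 ^ j) *: 'X^(2 ^ j - 1).
have ST j : Shat (T j) = T j + T j.+1.
  rewrite /T -mul_polyC ShatM ShatC ShatXn rmorphXn /= StX /Stvar.
  have -> : ((('X_i)%:P + 'X_i ^+ 2 *: 'X) ^+ (2 ^ j) : {poly Pk k}) =
            (('X_i) ^+ (2 ^ j))%:P + 'X_i ^+ (2 ^ j.+1) *: 'X^(2 ^ j).
    elim: j => [|j IH]; first by rewrite !expr1.
    rewrite expnSr exprM IH.
    rewrite expr2_polyD.
    by rewrite -rmorphXn /= -exprM exprZn -!exprM -!expnSr.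
  rewrite mulrDl mul_polyC -scalerAl -exprD; congr (_ + _ *: 'X^_).
  by rewrite expnS; have := expn_gt0 2 j; lia.
have E : ('X_i)%:P = T 0%N by rewrite /T expn0 subnn expr0 expr1 alg_polyC.
rewrite E -[_ *: _]/(T n.+1) /Uvar; elim: n => [|n IH].
  by rewrite big_ord_recl big_ord0 addr0 -[_ *: _]/(T 0%N) ST.
rewrite big_ord_recr /= ShatD IH -[X in Shat X]/(T n.+1) ST.
by rewrite addrA -(addrA (T 0%N)) (addrr_pchar2 (pchar_polyPk k)) addr0.
Qed.

(** Apply the multiplicative [Shat] to the product of the [Uvar] times [v]; below degree [2 ^ n] the
    first factor becomes [vprod r]. The term [b = m] on the right is the only one that is not
    visibly hit. *)
Lemma chi_trick n m r v : (m < 2 ^ n)%N ->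
  vprod r * Sq m v = \sum_(b < m.+1) Sq (m - b) (chi n b r * v).
Proof.
move=> lt_m.
have -> : \sum_(b < m.+1) Sq (m - b) (chi n b r * v) =
          (Shat ((\prod_(i <- r) Uvar n i) * v%:P))`_m.
  by rewrite coef_Shat; apply: eq_bigr => b _; rewrite coefMC.
rewrite ShatM ShatC SqE -coefCM; apply: (@coefM_trunc _ _ _ _ _ m) => // {v} j le_j.
rewrite (big_morph Shat ShatM (ShatC 1)) (_ : St _ = 1) ?rmorph1 //.
rewrite /vprod (big_morph _ (polyCM (R := Pk k)) (erefl : 1%:P = 1 :> {poly Pk k})).
move: j le_j.
apply: (big_ind2 (fun p q : {poly Pk k} => forall l, (l <= m)%N -> p`_l = q`_l)) => //.
  by move=> p q r' s pq rs l; apply: coefM_trunc.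
move=> i _ l li; rewrite Shat_Uvar coefD coefZ coefXn (_ : l == _ = false) ?mulr0 ?addr0 //.
apply/eqP; rewrite expnS; lia.
Qed.

(** A nonzero term would write [b + size r] as a sum of [size r] powers of two, which is impossible
    with more digits than summands. *)
Lemma chi_eq0 n b r : (size r < alpha (b + size r))%N -> chi n b r = 0.
Proof.
rewrite /chi; elim: r b => [|i r IH] b.
  rewrite big_nil coef1 addn0 /=; case: b => //.
rewrite big_cons coefM => lt_b; rewrite big1 // => j _.
case: (coef_Uvar n i j) => [->|[e [je _]]]; first by rewrite mul0r.
rewrite IH ?mulr0 //; have := alpha_leD (2 ^ e) (b - j + size r).
rewrite alpha_exp2; have -> : (2 ^ e + (b - j + size r) = b + (size r).+1)%N.
  by have := ltn_ord j; lia.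
by move: lt_b => /=; lia.
Qed.

Lemma dhomog_var (i : 'I_k) : ('X_i : Pk k) \is 1.-homog.
Proof. by rewrite dhomogX; apply/eqP; apply: mdeg1. Qed.

Lemma dhomog_chi n b r : chi n b r \is (size r + b).-homog.
Proof.
rewrite /chi; elim: r b => [|i r IH] b.
  by rewrite big_nil coef1; case: b => [|b]; rewrite ?dhomog1 ?dhomog0.
rewrite big_cons coefM; apply: rpred_sum => j _.
case: (coef_Uvar n i j) => [->|[e [je ->]]]; first by rewrite mul0r dhomog0.
have -> : (size (i :: r) + b = 1 * j.+1 + (size r + (b - j)))%N.
  by have := ltn_ord j; rewrite /=; lia.
by apply: dhomogM; rewrite ?IH //; apply: dhomogMn; apply: dhomog_var.
Qed.

Lemma chi_nil n b : (0 < b)%N -> chi n b [::] = 0.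
Proof. by case: b => // b _; rewrite /chi big_nil coef1. Qed.

Definition Yset S : Pk k := \prod_(i in S) 'X_i.

Lemma vprod_enum S : vprod (enum S) = Yset S.
Proof. by rewrite /vprod /Yset big_enum. Qed.

Lemma dhomog_vprod r : vprod r \is (size r).-homog.
Proof.
rewrite /vprod; elim: r => [|i r IH]; first by rewrite big_nil dhomog1.
by rewrite big_cons; apply: (dhomogM (d := 1)) => //; apply: dhomog_var.
Qed.

Lemma dhomog_Yset S : Yset S \is #|S|.-homog.
Proof. by rewrite -vprod_enum cardE dhomog_vprod. Qed.

(* Splitting off, for each variable, the linear term of the conjugate total
   square: what remains is a square. *)
Lemma chi_enum n b S : chi n.+1 b (enum S) =
  \sum_(J : {set 'I_k} | [&& J \subset S, #|S :\: J| <= b & ~~ odd (b - #|S :\: J|)]%N)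
    Yset J * chi n (b - #|S :\: J|)%N./2 (enum (S :\: J)) ^+ 2.
Proof.
rewrite /chi big_enum /= big_mkcond /=.
pose F i : {poly Pk k} := if i \in S then ('X_i)%:P else 0.
pose G i : {poly Pk k} := if i \in S then 'X * Uvar n i ^+ 2 else 1.
rewrite (eq_bigr (fun i => F i + G i)); last first.
  by move=> i _; rewrite /F /G; case: (i \in S); [exact: UvarS|rewrite add0r].
rewrite bigA_distr coef_sum [RHS]big_mkcond; apply: eq_bigr => J _.
have [JS|/subsetPn[i iJ iS]] := boolP (J \subset S); last first.
  by rewrite (bigD1 i) //= iJ /F (negPf iS) mul0r coef0.
have -> : \prod_i (if i \in J then F i else G i) =
    'X^#|S :\: J| * ((Yset J)%:P * (\prod_(i in S :\: J) Uvar n i) ^+ 2).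
  rewrite (bigID (mem J)) /= [RHS]mulrCA; congr (_ * _).
    rewrite /Yset (big_morph _ (polyCM (R := Pk k)) (erefl : 1%:P = 1 :> {poly Pk k})).
    by apply: eq_bigr => i iJ; rewrite iJ /F (subsetP JS).
  rewrite -prodrXl -prodr_const -big_split /= (bigID (mem S)) /=.
  rewrite [X in _ * X]big1 ?mulr1; last first.
    by move=> i /andP[iJ iS]; rewrite (negPf iJ) /G (negPf iS).
  apply: eq_big => [i|i /andP[iJ iS]]; first by rewrite inE.
  by rewrite (negPf iJ) /G iS.
rewrite coefXnM ltnNge big_enum /=; case: leqP => //= le_b.
by rewrite coefCM coef_polyX2; case: odd; rewrite ?mulr0.
Qed.

End ChiTrick.

(** * Homogeneous presentations of hit polynomials *)

Section HitLists.
Variable k : nat.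

Lemma size_enum (S : {set 'I_k}) : size (enum S) = #|S|.
Proof. by rewrite cardE. Qed.

Implicit Types (f g d : Pk k) (l : seq (nat * Pk k)).

Definition hlist D l : Prop := forall (a : nat) g, (a, g) \in l ->
  (0 < a)%N /\ exists2 e, (e + a = D)%N & g \is e.-homog.

(* A presentation of [f] as a hit polynomial, remembering the polynomial [d]
   obtained by lowering the degree of every square by one. *)
Definition dec D f d : Prop := exists l,
  [/\ hlist D l, f = \sum_(x <- l) Sq x.1 x.2 & d = \sum_(x <- l) Sq x.1.-1 x.2].

Definition hitn D f : Prop := exists d, dec D f d.

(** When [Yset S * f ^+ 2] is expanded, a term that loses exactly the two variables of [P] involves
    a polynomial congruent to [Yset P * d]; the condition is what controls these terms. *)
Definition good D f : Prop := exists d, dec D f d /\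
  forall P : {set 'I_k}, #|P| = 2%N -> hitn D.+1 (Yset P * d).

Lemma mulr_sqr f g d : f * (g * d) ^+ 2 = f * g ^+ 2 * d ^+ 2.
Proof. by rewrite exprMn mulrA. Qed.

Lemma dec0 D : dec D 0 0.
Proof. by exists [::]; split=> //; rewrite big_nil. Qed.

Lemma decD D f d f' d' : dec D f d -> dec D f' d' -> dec D (f + f') (d + d').
Proof.
move=> [l [hl -> ->]] [l' [hl' -> ->]]; exists (l ++ l'); rewrite !big_cat.
by split=> // a g; rewrite mem_cat => /orP[/hl|/hl'].
Qed.

Lemma dec_sum D (I : eqType) (r : seq I) (P : pred I) (F G : I -> Pk k) :
  (forall i, i \in r -> P i -> dec D (F i) (G i)) ->
  dec D (\sum_(i <- r | P i) F i) (\sum_(i <- r | P i) G i).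
Proof.
elim: r => [|i r IH] H; first by rewrite !big_nil; apply: dec0.
have {}IH := IH (fun j jr => H j (mem_behead (s := i :: r) jr)).
rewrite !big_cons; case: ifP => // Pi; apply: decD => //.
by apply: H; rewrite ?mem_head.
Qed.

Lemma dec_Sq D a e g : (0 < a)%N -> g \is e.-homog -> (e + a = D)%N ->
  dec D (Sq a g) (Sq a.-1 g).
Proof.
move=> a0 hg eD; exists [:: (a, g)]; rewrite !big_seq1; split=> // b h.
by rewrite inE => /eqP[-> ->]; split=> //; exists e.
Qed.

Lemma hitn0 D : hitn D 0. Proof. by exists 0; apply: dec0. Qed.

Lemma hitnD D f g : hitn D f -> hitn D g -> hitn D (f + g).
Proof. by move=> [d hd] [d' hd']; exists (d + d'); apply: decD. Qed.

Lemma hitn_sum D (I : eqType) (r : seq I) (P : pred I) (F : I -> Pk k) :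
  (forall i, i \in r -> P i -> hitn D (F i)) -> hitn D (\sum_(i <- r | P i) F i).
Proof.
move=> H; rewrite big_seq_cond.
by apply: big_ind => [||i /andP[]]; [apply: hitn0|apply: hitnD|apply: H].
Qed.

Lemma hitn_Sq D a e g : (0 < a)%N -> g \is e.-homog -> (e + a = D)%N -> hitn D (Sq a g).
Proof. by move=> a0 hg eD; eexists; apply: dec_Sq hg eD. Qed.

Lemma hitnDr D f g : hitn D g -> hitn D (f + g) -> hitn D f.
Proof. by move=> hg hfg; rewrite -(addppK f g); apply: hitnD. Qed.

Lemma good0 D : good D 0.
Proof. by exists 0; split; [apply: dec0|move=> P _; rewrite mulr0; apply: hitn0]. Qed.

Lemma goodD D f g : good D f -> good D g -> good D (f + g).
Proof.
move=> [d [hd Hd]] [d' [hd' Hd']]; exists (d + d'); split; first exact: decD.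
by move=> P P2; rewrite mulrDr; apply: hitnD; [apply: Hd|apply: Hd'].
Qed.

Lemma good_sum D (I : eqType) (r : seq I) (P : pred I) (F : I -> Pk k) :
  (forall i, i \in r -> P i -> good D (F i)) -> good D (\sum_(i <- r | P i) F i).
Proof.
move=> H; rewrite big_seq_cond.
by apply: big_ind => [||i /andP[]]; [apply: good0|apply: goodD|apply: H].
Qed.

Lemma goodDr D f g : good D g -> good D (f + g) -> good D f.
Proof. by move=> hg hfg; rewrite -(addppK f g); apply: goodD. Qed.

Lemma good_dec0 D f : dec D f 0 -> good D f.
Proof. by move=> h; exists 0; split=> // P _; rewrite mulr0; apply: hitn0. Qed.

Lemma hit0 : hit (0 : Pk k).
Proof. by exists [::]; rewrite big_nil. Qed.

Lemma hitD f g : hit f -> hit g -> hit (f + g).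
Proof.
move=> [l [hl ->]] [l' [hl' ->]]; exists (l ++ l'); rewrite !big_cat.
by split=> // x; rewrite mem_cat => /orP[/hl|/hl'].
Qed.

Lemma hit_sum (I : eqType) (r : seq I) (P : pred I) (F : I -> Pk k) :
  (forall i, i \in r -> P i -> hit (F i)) -> hit (\sum_(i <- r | P i) F i).
Proof.
move=> H; rewrite big_seq_cond.
by apply: big_ind => [||i /andP[]]; [apply: hit0|apply: hitD|apply: H].
Qed.

Lemma hit_Sq a g : (0 < a)%N -> hit (Sq a g).
Proof.
move=> a0; exists [:: (a, g)]; rewrite big_seq1; split=> // x.
by rewrite inE => /eqP ->.
Qed.

Lemma hitn_hit D f : hitn D f -> hit f.
Proof. by move=> [d [l [hl -> _]]]; exists l; split=> // -[a g] /hl[]. Qed.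

Lemma pihomog_Sq D a g : pihomog mdeg D (Sq a g) =
  if (a <= D)%N then Sq a (pihomog mdeg (D - a)%N g) else 0.
Proof.
have HX m : pihomog mdeg D (Sq a 'X_[m]) =
    if (a <= D)%N then Sq a (pihomog mdeg (D - a)%N ('X_[m] : Pk k)) else 0.
  have hX : Sq a ('X_[m] : Pk k) \is (mdeg m + a).-homog.
    by apply: dhomog_Sq; rewrite dhomogX.
  have [e|ne] := eqVneq (mdeg m + a)%N D.
    rewrite -{1}e (pihomog_dE hX) -e leq_addl addnK pihomogX.
    by rewrite (_ : (_ == _) = true) //; apply/eqP.
  rewrite (pihomog_ne0 ne hX).
  case: leqP => // aD; rewrite pihomogX (_ : (_ == _) = false) ?Sq0 //.
  by apply/eqP => e; case/eqP: ne; move: e => /=; lia.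
rewrite [g]mpolyE_F2 Sq_sum !raddf_sum Sq_sum /=.
rewrite (eq_bigr _ (fun m _ => HX m)).
by case: ifP => // _; rewrite big1.
Qed.

(** Projecting every square of a presentation onto degree [D] makes the presentation homogeneous. *)
Lemma hit_hitn D f : f \is D.-homog -> hit f -> hitn D f.
Proof.
move=> hf [l [hl e]]; rewrite -(pihomog_dE hf) e raddf_sum.
apply: hitn_sum => x /hl x0 _; rewrite /= pihomog_Sq; case: leqP => // xD.
  by apply: (hitn_Sq x0 (pihomogP _ _ _)); rewrite subnK.
exact: hitn0.
Qed.

Lemma hit_pihomog D f : hit f -> hit (pihomog mdeg D f).
Proof.
move=> [l [hl ->]]; rewrite raddf_sum; apply: hit_sum => x /hl x0 _ /=.
by rewrite pihomog_Sq; case: leqP => _; [apply: hit_Sq|apply: hit0].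
Qed.

(** The expansions of [chi_trick] for [m] and for [m - 1] have the same arguments with squares
    differing by one degree, so the second is the lowering of the first. *)
Lemma trick_dec n m (r : seq 'I_k) v e D : (0 < m < 2 ^ n)%N -> v \is e.-homog ->
  (size r + m + e = D)%N ->
  dec D (vprod r * Sq m v + chi n m r * v) (vprod r * Sq m.-1 v).
Proof.
move=> /andP[m0 mn] hv eD; rewrite (chi_trick _ _ mn) big_ord_recr /= subnn Sq_0 addppK.
have mn' : (m.-1 < 2 ^ n)%N by lia.
rewrite (chi_trick _ _ mn') prednK //.
apply: dec_sum => b _ _; rewrite -subn1 subnAC subn1.
apply: (@dec_Sq _ _ (size r + b + e)%N); last by have := ltn_ord b; lia.
  by have := ltn_ord b; lia.
by apply: dhomogM => //; apply: dhomog_chi.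
Qed.

Lemma trick_hitn n m (r : seq 'I_k) v e D : (m < 2 ^ n)%N -> v \is e.-homog ->
  (size r + m + e = D)%N -> hitn D (vprod r * Sq m v + chi n m r * v).
Proof.
case: (posnP m) => [-> _ _ _|m0 mn hv eD].
  rewrite (@chi_trick _ n) ?expn_gt0 // big_ord1 subnn Sq_0 addpp.
  exact: hitn0.
by eexists; apply: trick_dec hv eD; rewrite m0.
Qed.

(* [Y_S (sum Sq^a g)^2 = sum Y_S Sq^(2a) (g^2)] is rewritten modulo hits with
   the conjugation trick; the odd squares of [g^2] vanish, so that this is
   also harmless for lowered presentations. *)
Lemma square_expand n (S : {set 'I_k}) D l : hlist D l -> (2 * D < 2 ^ n)%N ->
  dec (#|S| + 2 * D) (Yset S * (\sum_(x <- l) Sq x.1 x.2) ^+ 2 +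
    \sum_(J : {set 'I_k} | (J \proper S) && ~~ odd #|S :\: J|)
      Yset J * (\sum_(x <- l | (#|S :\: J| <= 2 * x.1)%N)
                  chi n (x.1 - #|S :\: J|./2)%N (enum (S :\: J)) * x.2) ^+ 2) 0.
Proof.
move=> hl Dn.
have H (a : nat) g : (a, g) \in l -> dec (#|S| + 2 * D)
    (Yset S * (Sq a g) ^+ 2 + chi n.+1 (2 * a) (enum S) * g ^+ 2) 0.
  move=> /hl[a0 [e eD hg]].
  have -> : Sq a g ^+ 2 = Sq (2 * a)%N (g ^+ 2).
    by rewrite Sq_square mul2n odd_double half_double.
  have -> : 0 = vprod (enum S) * Sq (2 * a)%N.-1 (g ^+ 2).
    by rewrite Sq_square (_ : odd _) ?mulr0 //; lia.
  rewrite -vprod_enum; apply: (@trick_dec _ _ _ _ (e * 2)).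
  - by apply/andP; split; [lia|rewrite expnS; lia].
  - exact: dhomogMn.
  - by rewrite size_enum; lia.
have -> : Yset S * (\sum_(x <- l) Sq x.1 x.2) ^+ 2 +
    \sum_(J : {set 'I_k} | (J \proper S) && ~~ odd #|S :\: J|)
      Yset J * (\sum_(x <- l | (#|S :\: J| <= 2 * x.1)%N)
                  chi n (x.1 - #|S :\: J|./2)%N (enum (S :\: J)) * x.2) ^+ 2 =
   \sum_(x <- l) (Yset S * (Sq x.1 x.2) ^+ 2 + chi n.+1 (2 * x.1) (enum S) * x.2 ^+ 2).
  rewrite big_split /= expp2_sum mulr_sumr; congr (_ + _).
  under eq_bigr => J _ do rewrite expp2_sum mulr_sumr big_mkcond.
  rewrite exchange_big /=; apply: eq_big_seq => -[a g] /hl[a0 _] /=.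
  rewrite chi_enum mulr_suml [RHS]big_mkcond [LHS]big_mkcond; apply: eq_bigr => J _.
  rewrite properEneq; have [JS|_] := boolP (J \subset S); last by rewrite andbF.
  (* The term [J = S] vanishes because [a > 0], so only proper subsets remain. *)
  have [->|nJ] := eqVneq J S.
    rewrite setDv enum_set0 cards0 subn0 /=.
    by rewrite chi_nil ?expr0n ?mulr0 ?mul0r ?if_same //; lia.
  rewrite /=; case: leqP => le; last by rewrite if_same.
  rewrite oddB // mul2n odd_double /=.
  case oJ : (odd _); first by [].
  rewrite [~~ _]/=; set c := (a - _)%N.
  have -> : c = (a.*2 - #|S :\: J|)./2 by rewrite /c -mul2n; move: le oJ; move: #|_| => m; lia.
  exact: mulr_sqr.
have E : 0 = \sum_(x <- l) (0 : Pk k) by rewrite big1.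
by rewrite [X in dec _ _ X]E; apply: dec_sum => -[a g] /H.
Qed.

Lemma square_expand_homog n (S J : {set 'I_k}) D l : hlist D l ->
  J \subset S -> ~~ odd #|S :\: J| ->
  \sum_(x <- l | (#|S :\: J| <= 2 * x.1)%N)
     chi n (x.1 - #|S :\: J|./2)%N (enum (S :\: J)) * x.2 \is (#|S :\: J|./2 + D).-homog.
Proof.
move=> hl JS oJ; rewrite big_seq_cond; apply: rpred_sum => -[a g] /andP[/hl[a0 [e eD hg]] /= le].
have -> : (#|S :\: J|./2 + D = size (enum (S :\: J)) + (a - #|S :\: J|./2) + e)%N.
  by rewrite size_enum; move: oJ le; move: #|S :\: J| => c; lia.
by apply: dhomogM => //; apply: dhomog_chi.
Qed.

End HitLists.

(** * Hit polynomials in the degrees [2 ^ e * M0 - s] *)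

Section HitDegrees.
Variables (k s M0 : nat).
Hypothesis base : spike_base s M0.
Implicit Types (S J P : {set 'I_k}) (g w : Pk k).

Lemma proper_card_even S J : J \proper S -> ~~ odd #|S :\: J| ->
  (#|J| + #|S :\: J| = #|S|)%N /\ (2 <= #|S :\: J|)%N.
Proof.
move=> /properP[JS [i iS iJ]] oJ; have E : (#|J| + #|S :\: J| = #|S|)%N.
  by rewrite -(cardsID J S) (setIidPr JS).
split=> //; have : (0 < #|S :\: J|)%N by apply/card_gt0P; exists i; rewrite inE iJ.
by lia.
Qed.

(** Write [g ^+ 2] as the top square of [g] and conjugate: the remaining [chi] vanishes, by the
    digit bound at [q = s - #|S|]. *)
Lemma hitn_small e S g D : (#|S| < s)%N -> g \is D.-homog ->
  (#|S| + 2 * D + s = 2 ^ e.+1 * M0)%N -> hitn (#|S| + 2 * D) (Yset S * g ^+ 2).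
Proof.
move=> Ss hg eM; rewrite -(Sq_deg hg) -vprod_enum.
have := @trick_hitn _ D D (enum S) g D _ (ltn_expl D (isT : (1 < 2)%N)) hg (erefl _).
rewrite chi_eq0 ?mul0r ?addr0 size_enum; first by rewrite mul2n -addnn addnA.
have := @spike_base_lift s M0 e.+1 (s - #|S|) base ltac:(lia).
have -> : (2 ^ e.+1 * M0 - (s - #|S|) = 2 * (D + #|S|))%N by lia.
by rewrite alpha_double; have := alpha_le (s - #|S|).-1; lia.
Qed.

(** Every term left by [square_expand] has fewer than [s] odd variables. *)
Lemma hitn_square e S w D : #|S| = s -> hitn D w ->
  (s + 2 * D + s = 2 ^ e.+1 * M0)%N -> hitn (s + 2 * D) (Yset S * w ^+ 2).
Proof.
move=> Ss [d [l [hl -> _]]] eM; rewrite -Ss.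
apply: hitnDr; last by eexists; apply: (square_expand _ hl (ltn_expl _ (isT : (1 < 2)%N))).
apply: hitn_sum => J _ /andP[JS oJ]; have [EJ J2] := proper_card_even JS oJ.
have -> : (#|S| + 2 * D = #|J| + 2 * (#|S :\: J|./2 + D))%N by lia.
apply: (@hitn_small e); try lia.
exact: square_expand_homog (proper_sub JS) oJ.
Qed.

(** The argument of [hitn_small] is used twice, for the polynomial and for its lowering times two
    variables, with the digit bound at [s - #|S| + 1] and at [s - #|S| - 1]. *)
Lemma good_small e S g D : (#|S| + 3 <= s)%N -> g \is D.-homog ->
  (#|S| + 2 * D + 1 + s = 2 ^ e.+1 * M0)%N -> (0 < e)%N || (#|S| + 5 <= s)%N ->
  good (#|S| + 2 * D) (Yset S * g ^+ 2).
Proof.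
move=> + hg; rewrite -(Sq_deg hg) -vprod_enum; move Er: #|S| => r Ss eM He.
have al : (r < alpha (D + r))%N.
  have := @spike_base_lift s M0 e.+1 (s - r).+1 base ltac:(lia).
  have -> : (2 ^ e.+1 * M0 - (s - r).+1 = 2 * (D + r))%N by lia.
  by rewrite alpha_double succnK; have := @alpha_lt (s - r) ltac:(lia); lia.
have D0 : (0 < D)%N.
  by case: (posnP D) al => // ->; rewrite add0n ltnNge alpha_le.
have H0 : (0 < D < 2 ^ D)%N by rewrite D0 ltn_expl.
have := @trick_dec _ D D (enum S) g D _ H0 hg (erefl _).
rewrite chi_eq0 ?mul0r ?addr0 size_enum Er // => H; exists (vprod (enum S) * Sq D.-1 g).
split; first by move: H; rewrite mul2n -addnn addnA.
move=> P P2; rewrite mulrA -vprod_enum.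
(* [P] and [S] may overlap, hence a [chi] on sequences and not on sets. *)
have -> : vprod (enum P) * vprod (enum S) = vprod (enum P ++ enum S).
  by rewrite /vprod big_cat.
have D1 : (D.-1 < 2 ^ D)%N by lia.
have := @trick_hitn _ D D.-1 (enum P ++ enum S) g D _ D1 hg (erefl _).
rewrite size_cat !size_enum P2 Er chi_eq0 ?mul0r ?addr0.
  by have -> : (2 + r + D.-1 + D = (r + 2 * D).+1)%N by lia.
rewrite size_cat !size_enum P2 Er.
have := @spike_base_lift s M0 e.+1 (s - r).-1 base ltac:(lia).
have -> : (2 ^ e.+1 * M0 - (s - r).-1 = 2 * (D.-1 + (2 + r)))%N by lia.
(* One more digit is needed here: it comes from [e > 0], or else from
   [alpha (s - r - 2) < s - r - 2]. *)
rewrite alpha_double; case/orP: He => He.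
  by have := alpha_le (s - r).-1.-1; lia.
by have := @alpha_lt (s - r).-1.-1 ltac:(lia); lia.
Qed.

(** The expansion has zero lowering, and its other terms have at most [s - 3] odd variables. *)
Lemma good_square_hitn e S w D : (#|S| + 1 = s)%N -> hitn D w ->
  (#|S| + 2 * D + 1 + s = 2 ^ e.+2 * M0)%N -> good (#|S| + 2 * D) (Yset S * w ^+ 2).
Proof.
move=> Ss [d [l [hl -> _]]] eM.
apply: goodDr; last first.
  by apply: good_dec0; apply: (square_expand _ hl (ltn_expl _ (isT : (1 < 2)%N))).
apply: good_sum => J _ /andP[JS oJ]; have [EJ J2] := proper_card_even JS oJ.
have -> : (#|S| + 2 * D = #|J| + 2 * (#|S :\: J|./2 + D))%N by lia.
apply: (@good_small e.+1) => //; try lia.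
exact: square_expand_homog (proper_sub JS) oJ.
Qed.

(** The sum on the right is the factor squared in [square_expand] for [S :\: J = P]. Conjugating
    each [Sq (a - 1)] past [Yset P] identifies it, modulo hits, with the lowered polynomial times
    [Yset P]. *)
Lemma lowered_hitn n D (l : seq (nat * Pk k)) P : hlist D l -> (2 * D < 2 ^ n)%N ->
  #|P| = 2%N -> hitn D.+1 (Yset P * \sum_(x <- l) Sq x.1.-1 x.2) ->
  hitn (1 + D) (\sum_(x <- l | (2 <= 2 * x.1)%N) chi n (x.1 - 1)%N (enum P) * x.2).
Proof.
move=> hl Dn P2 hd; rewrite add1n; apply: (hitnDr hd).
have -> : \sum_(x <- l | (2 <= 2 * x.1)%N) chi n (x.1 - 1)%N (enum P) * x.2 =
          \sum_(x <- l) chi n (x.1 - 1)%N (enum P) * x.2.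
  by rewrite [RHS]big_seq_cond [LHS]big_seq_cond; apply: eq_bigl => -[a g];
     case xl : (_ \in l) => //=; have [? _] := hl _ _ xl; lia.
rewrite mulr_sumr -big_split /=; apply: hitn_sum => -[a g] /hl[a0 [e eD hg]] _ /=.
rewrite addrC -vprod_enum subn1; apply: (trick_hitn _ hg); first lia.
by rewrite size_enum P2; lia.
Qed.

(** Terms losing two variables have [s - 1] left and are covered by [lowered_hitn] and
    [good_square_hitn]; all others have at most [s - 3] left. *)
Lemma good_square e S w D : #|S| = s.+1 -> good D w ->
  (#|S| + 2 * D + 1 + s = 2 ^ e.+2 * M0)%N -> good (#|S| + 2 * D) (Yset S * w ^+ 2).
Proof.
move=> Ss [d [[l [hl -> ->]] Hd]] eM.
have Dn : (2 * D < 2 ^ (2 * D))%N by apply: ltn_expl.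
apply: goodDr; last by apply: good_dec0; apply: (square_expand _ hl Dn).
apply: good_sum => J _ /andP[JS oJ]; have [EJ J2] := proper_card_even JS oJ.
have -> : (#|S| + 2 * D = #|J| + 2 * (#|S :\: J|./2 + D))%N by lia.
have [J3|J3] := eqVneq #|S :\: J| 2%N.
  apply: (@good_square_hitn e); try lia.
  by rewrite J3; apply: (lowered_hitn hl Dn J3); apply: Hd.
apply: (@good_small e.+1) => //; try lia.
exact: square_expand_homog (proper_sub JS) oJ.
Qed.

Lemma hitn_square_good e S w D : #|S| = s.+2 -> good D w ->
  (#|S| + 2 * D + s = 2 ^ e.+1 * M0)%N -> hitn (#|S| + 2 * D) (Yset S * w ^+ 2).
Proof.
move=> Ss [d [[l [hl -> ->]] Hd]] eM.
have Dn : (2 * D < 2 ^ (2 * D))%N by apply: ltn_expl.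
apply: hitnDr; last by eexists; apply: (square_expand _ hl Dn).
apply: hitn_sum => J _ /andP[JS oJ]; have [EJ J2] := proper_card_even JS oJ.
have -> : (#|S| + 2 * D = #|J| + 2 * (#|S :\: J|./2 + D))%N by lia.
have [J3|J3] := eqVneq #|S :\: J| 2%N.
  have Js : #|J| = s by lia.
  rewrite Js; apply: (@hitn_square e) => //; last by lia.
  by rewrite J3; apply: (lowered_hitn hl Dn J3); apply: Hd.
apply: (@hitn_small e) => //; try lia.
exact: square_expand_homog (proper_sub JS) oJ.
Qed.

End HitDegrees.

(** * Odd parts, halves and weights of monomials *)

Section Monomials.
Variable k : nat.
Implicit Types (m y : 'X_{1..k}) (S : {set 'I_k}).

Definition oddset m : {set 'I_k} := [set i | odd (m i)].
Definition halfm m : 'X_{1..k} := [multinom (m i)./2 | i < k].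

Lemma YsetE S : Yset S = 'X_[[multinom (i \in S : nat) | i < k]].
Proof.
rewrite mpolyXE_id /Yset big_mkcond; apply: eq_bigr => i _.
by rewrite mnmE; case: (i \in S); rewrite ?expr1 ?expr0.
Qed.

Lemma mpolyX_split m : 'X_[m] = Yset (oddset m) * 'X_[halfm m] ^+ 2 :> Pk k.
Proof.
rewrite YsetE mpolyXn -mpolyXD; congr 'X_[_]; apply/mnmP => i.
by rewrite mnmDE mulmnE !mnmE inE; case: (odd _) (odd_double_half (m i)) => /=; lia.
Qed.

Lemma omega0 m : omega m 0 = #|oddset m|.
Proof.
rewrite /omega -sum1_card [RHS]big_mkcond; apply: eq_bigr => i _.
by rewrite inE expn0 divn1; case: (odd _).
Qed.

Lemma omegaS m i : omega m i.+1 = omega (halfm m) i.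
Proof.
by apply: eq_bigr => j _; rewrite mnmE expnS divnMA -[(m j)./2]divn2.
Qed.

Lemma mdeg_split m : mdeg m = (#|oddset m| + 2 * mdeg (halfm m))%N.
Proof.
rewrite !mdegE big_distrr /= -sum1_card [X in (X + _)%N]big_mkcond -big_split /=.
by apply: eq_bigr => i _; rewrite mnmE inE; case: (odd _) (odd_double_half (m i)) => /=; lia.
Qed.

Definition wsum h m : nat := (\sum_(j < h) 2 ^ j * omega m j)%N.

Lemma wsumS h m : wsum h.+1 m = (#|oddset m| + 2 * wsum h (halfm m))%N.
Proof.
rewrite /wsum big_ord_recl expn0 mul1n omega0 big_distrr /=; congr addn.
by apply: eq_bigr => j _; rewrite -[bump _ _]/(j.+1) omegaS expnS mulnA.
Qed.

(** Here [v] is [m] with the lowest [h] binary digits of each exponent deleted. *)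
Lemma mdeg_wsum h m : exists2 v : 'X_{1..k},
  mdeg m = (wsum h m + 2 ^ h * mdeg v)%N & omega m h = #|oddset v|.
Proof.
elim: h m => [|h IH] m.
  by exists m; rewrite ?omega0 // /wsum big_ord0 mul1n.
have [v e1 e2] := IH (halfm m); exists v; last by rewrite omegaS.
by rewrite wsumS mdeg_split e1 expnS; lia.
Qed.

Lemma wsum_recr h m : wsum h.+1 m = (wsum h m + 2 ^ h * omega m h)%N.
Proof. by rewrite /wsum big_ord_recr. Qed.

Lemma leq_wsum h h' m : (h <= h')%N -> (wsum h m <= wsum h' m)%N.
Proof.
move/subnK <-; elim: (h' - h)%N => // i IH.
by rewrite addSn wsum_recr; apply: leq_trans IH (leq_addr _ _).
Qed.

Lemma omega_addXn d i m y : (i < d)%N -> omega (m + y *+ (2 ^ d))%MM i = omega m i.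
Proof.
move=> lt_i; apply: eq_bigr => j _; rewrite mnmDE mulmnE.
have -> : (2 ^ d = 2 ^ (d - i.+1) * 2 * 2 ^ i)%N.
  by rewrite -expnSr -expnD; congr (_ ^ _)%N; lia.
by rewrite !mulnA addnC divnMDl ?expn_gt0 // oddD oddM andbF.
Qed.

Lemma wsum_addXn d h m y : (h <= d)%N -> wsum h (m + y *+ (2 ^ d))%MM = wsum h m.
Proof.
move=> hd; apply: eq_bigr => j _; rewrite omega_addXn //.
exact: leq_trans (ltn_ord j) hd.
Qed.

End Monomials.

(** * Criteria for monomials of small weight to be hit *)

Section Criterion.
Variables (k s M0 : nat).
Hypothesis base : spike_base s M0.
Hypothesis ks : k = s.+2.
Implicit Types (m y : 'X_{1..k}).

Lemma card_oddset m : (#|oddset m| <= s.+2)%N.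
Proof. by rewrite -ks -[X in (_ <= X)%N](card_ord k) max_card. Qed.

(* The weights of [m] sum up to less than those of a spike: this is the
   Silverman-Singer criterion, for the degrees [2 ^ e * M0 - s] only.  In the
   induction on the weights the degree may drop by one, when all variables
   occur to an odd power, and then the stronger conclusion [good] is needed. *)
Lemma weight_criterion h :
  (forall e m c, (mdeg m + s = 2 ^ e * M0)%N -> (h <= e)%N -> (0 < c)%N ->
     [|| h < e, 1 < c | s <= 2]%N -> (wsum h m + 2 ^ h * c + s <= 2 ^ h * s)%N ->
     hitn (mdeg m) ('X_[m] : Pk k)) /\
  (forall e m c, (mdeg m + 1 + s = 2 ^ e * M0)%N -> (h <= e)%N -> (0 < c)%N ->
     [|| h < e, 1 < c | s <= 2]%N -> (wsum h m + 1 + 2 ^ h * c + s <= 2 ^ h * s)%N ->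
     good (mdeg m) ('X_[m] : Pk k)).
Proof.
elim: h => [|h [IH0 IH1]]; first by split=> e m c; rewrite /wsum big_ord0; lia.
split=> -[//|e] m c; rewrite ltnS wsumS (mdeg_split m) mpolyX_split.
  have := card_oddset m; move Er: #|oddset m| => r le_r eM he c0 Hc.
  rewrite expnS => Hw.
  have hX : ('X_[halfm m] : Pk k) \is (mdeg (halfm m)).-homog by rewrite dhomogX.
  have [rs|rs] := ltnP r s.
    by move: eM; rewrite -Er => eM; apply: (hitn_small base _ hX eM); rewrite Er.
  have [rs'|rs'] := eqVneq r s.
    rewrite rs'; apply: (hitn_square base (e := e)); [by rewrite Er| |by lia].
    by apply: (IH0 e _ c) => //; move: eM Hw; rewrite (expnS 2 e) -!mulnA; lia.
  (* Parity excludes [s + 1]. With all [s + 2] variables odd, halving costs one unit both in the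
     degree and in the weight inequality, which is the form of the second statement. *)
  have rs2 : r = s.+2 by move: eM; rewrite (expnS 2 e) -mulnA; lia.
  move: eM; rewrite -Er => eM; apply: (hitn_square_good base _ _ eM).
    by rewrite Er.
  by apply: (IH1 e _ c) => //; move: eM Hw; rewrite Er (expnS 2 e) -!mulnA; lia.
have := card_oddset m; move Er: #|oddset m| => r le_r eM he c0 Hc.
rewrite expnS => Hw.
have hX : ('X_[halfm m] : Pk k) \is (mdeg (halfm m)).-homog by rewrite dhomogX.
have par : odd r = ~~ odd s by move: eM; rewrite (expnS 2 e) -mulnA; lia.
have [rs|rs] := ltnP (r + 2) s.
  move: (eM); rewrite -Er => eM'; apply: (good_small base _ hX eM').
    by rewrite Er; lia.
  (* For [e = 0] the weight inequality reads [r + 1 + 2 c + s <= 2 s]; the slack [c > 1] gives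
     [r + 5 <= s], and [s <= 2] is impossible as [r + 2 < s]. *)
  rewrite Er; have [e0|//] := posnP e; have h0 : h = 0%N by lia.
  move: Hw Hc; rewrite h0 e0 expn0 /= /wsum big_ord0; lia.
have e1 : (0 < e)%N.
  case: e eM he Hc {hX} => // eM; rewrite leqn0 => /eqP h0.
  by move: Hw; rewrite h0 expn0 /wsum big_ord0; lia.
case: e e1 eM he Hc => // e _ eM he Hc.
have [rs1|rs1] := eqVneq (r + 1)%N s.
  move: (eM); rewrite -Er => eM'; apply: (good_square_hitn base _ _ eM').
    by rewrite Er.
  by apply: (IH0 e.+1 _ c) => //; move: eM Hw; rewrite (expnS 2 e.+1) -!mulnA; lia.
have rs2 : r = s.+1 by lia.
move: (eM); rewrite -Er => eM'; apply: (good_square base _ _ eM').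
  by rewrite Er.
by apply: (IH1 e.+1 _ c) => //; move: eM Hw; rewrite (expnS 2 e.+1) -!mulnA; lia.
Qed.

(** This handles the [Pminus] part of the relations: peel off the full weights with [hitn_square]
    until the deficient one makes [hitn_small] applicable. *)
Lemma low_weight i e m : (mdeg m + s = 2 ^ e * M0)%N -> (i < e)%N ->
  (forall j, (j < i)%N -> omega m j = s) -> (omega m i < s)%N ->
  hitn (mdeg m) ('X_[m] : Pk k).
Proof.
elim: i e m => [|i IH] [//|e] m; rewrite (mdeg_split m) mpolyX_split => eM ie ws wi.
  by apply: (hitn_small base _ _ eM); rewrite ?dhomogX // -omega0.
have Es : #|oddset m| = s by rewrite -omega0 ws.
move: eM; rewrite Es => eM; apply: (hitn_square base Es _ eM).
apply: (IH e) => //; first by move: eM; rewrite (expnS 2 e) -mulnA; lia.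
  by move=> j ji; rewrite -omegaS ws.
by rewrite -omegaS.
Qed.

End Criterion.

(** * Minimal spikes of degree [s (2 ^ d - 1)] *)

Lemma sum_count_exp2 h (e : seq nat) :
  (\sum_(j < h) 2 ^ j * count (fun u => j < u) e = \sum_(u <- e) (2 ^ minn u h - 1))%N.
Proof.
have E u : (\sum_(j < h) 2 ^ j * (j < u) = 2 ^ minn u h - 1)%N.
  elim: h => [|h IH]; first by rewrite big_ord0 minn0.
  rewrite big_ord_recr /= IH; case: (ltnP h u) => hu.
    by rewrite (minn_idPr hu) expnS; have := expn_gt0 2 h; lia.
  by rewrite (minn_idPl (leqW hu)) muln0 addn0.
under [RHS]eq_bigr => u _ do rewrite -E.
rewrite exchange_big /=; apply: eq_bigr => j _.
by rewrite -big_distrr /= -sum1_count [X in (_ * X)%N]big_mkcond.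
Qed.

Lemma min_spike_size s d e : (0 < d)%N ->
  min_spike_exps (s * (2 ^ d - 1)) e -> (size e <= s)%N.
Proof.
move=> d0 [_ _ mine _ _]; rewrite leqNgt; apply/negP => lt_s.
apply: (mine s lt_s); exists (nseq s d).
rewrite size_nseq map_nseq; split=> //; split.
  by move=> u /nseqP[-> _].
by rewrite sumn_nseq mulnC.
Qed.

(* Any spike exponents of [s * (2 ^ d - 1)] with at most [s] terms are all
   equal to [d], or one of them exceeds [d]; the former contradicts
   minimality as soon as [s > 2]. *)
Lemma min_spike_large s d e : (0 < d)%N -> (2 < s)%N ->
  min_spike_exps (s * (2 ^ d - 1)) e -> has (fun u => d < u)%N e.
Proof.
move=> d0 s2 spk; have le_s := min_spike_size d0 spk.
case: spk => e0 se mine dec1 dec2; apply/negPn/negP => /hasPn noe.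
have d1 : (0 < 2 ^ d - 1)%N by rewrite subn_gt0 -{1}(expn0 2) ltn_exp2l.
have {}noe u : u \in e -> (2 ^ u - 1 <= 2 ^ d - 1)%N.
  by move=> /noe; rewrite -leqNgt => ud; rewrite leq_sub2r // leq_exp2l.
have all_eq : forall e', (forall u, u \in e' -> (2 ^ u - 1 <= 2 ^ d - 1)%N) ->
    (sumn [seq (2 ^ u - 1)%N | u <- e'] <= size e' * (2 ^ d - 1))%N.
  elim=> //= u e' IH H; rewrite mulSn leq_add ?H ?mem_head //.
  by apply: IH => v ve; apply: H; rewrite inE ve orbT.
have size_e : size e = s.
  apply/eqP; rewrite eqn_leq le_s /= -(leq_pmul2r d1) -se; exact: all_eq.
have := dec1 0%N; rewrite size_e => /(_ s2).
case: e e0 se {mine dec1 dec2 le_s} noe size_e => [|u [|v e]] //= e0 se noe size_e; try lia.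
move=> vu.
have Hu : (2 ^ v - 1 < 2 ^ d - 1)%N.
  have := noe u (mem_head _ _); have : (2 ^ v < 2 ^ u)%N by rewrite ltn_exp2l.
  by have := expn_gt0 2 v; lia.
have := all_eq e (fun w we => noe w ltac:(by rewrite !inE we !orbT)).
have := noe u (mem_head _ _); move: se; rewrite -size_e.
move: (sumn _) => X; rewrite !mulSn; move: (size e * _)%N => Y; lia.
Qed.

(** This turns the condition in [Pkn] into the hypotheses of [weight_criterion]. A cut-off [h]
    beyond [d] is replaced by [d], and then the slack must be 2 if [s > 2]. *)
Lemma Pkn_weight k s d e h (m : 'X_{1..k}) : (0 < d)%N ->
  mdeg m = (s * (2 ^ d - 1))%N -> min_spike_exps (s * (2 ^ d - 1)) e ->
  (wsum h m < \sum_(j < h) 2 ^ j * count (fun u => j < u) e)%N ->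
  exists h' c, [/\ (h' <= d)%N, (0 < c)%N, [|| h' < d, 1 < c | s <= 2]%N &
    (wsum h' m + 2 ^ h' * c + s <= 2 ^ h' * s)%N].
Proof.
move=> d0 dm spk; rewrite sum_count_exp2 => lt_w.
have le_s := min_spike_size d0 spk; have [e0 se mine _ _] := spk.
have pow i : (0 < 2 ^ i)%N by rewrite expn_gt0.
(* This divisibility improves a strict inequality to a gap of [2 ^ i]. *)
have cong i : (i <= d)%N -> exists q, (wsum i m + s = 2 ^ i * q)%N.
  move=> id; have [v e1 _] := mdeg_wsum i m.
  exists (s * 2 ^ (d - i) - mdeg v)%N.
  rewrite mulnBr mulnCA -expnD subnKC //; move: e1; rewrite dm mulnBr muln1.
  have : (s <= s * 2 ^ d)%N by rewrite leq_pmulr.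
  by lia.
have [hd|dh] := ltnP h d.
  exists h, 1%N; split=> //; [exact: ltnW|by rewrite hd|].
  have [q Eq] := cong h (ltnW hd).
  have lt_q : (wsum h m + s < 2 ^ h * s)%N.
    apply: leq_trans (_ : (size e * (2 ^ h - 1) + s <= _)%N); last first.
      have : (size e * (2 ^ h - 1) <= s * (2 ^ h - 1))%N by rewrite leq_mul2r le_s orbT.
      by rewrite mulnBr; have : (s <= s * 2 ^ h)%N by [rewrite leq_pmulr]; lia.
    rewrite -addSn leq_add2r; apply: leq_trans lt_w _.
    elim: (e) => [|u e' IH]; first by rewrite big_nil.
    rewrite big_cons mulSn leq_add // leq_sub2r // leq_exp2l //; exact: geq_minr.
  rewrite muln1 addnAC Eq -mulnSr leq_pmul2l //.
  by rewrite Eq ltn_pmul2l in lt_q.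
have [q Eq] := cong d (leqnn d).
have lt_n : (\sum_(u <- e) (2 ^ minn u h - 1) <= s * (2 ^ d - 1))%N.
  rewrite -se; elim: (e) => [|u e' IH]; first by rewrite big_nil.
  rewrite big_cons /= leq_add // leq_sub2r // leq_exp2l //; exact: geq_minl.
have sd : (s <= s * 2 ^ d)%N by rewrite leq_pmulr.
have lt_q : (wsum d m + s < 2 ^ d * s)%N.
  have := leq_wsum m dh; move: lt_w lt_n; rewrite mulnBr muln1; lia.
have [s2|s2] := leqP s 2.
  exists d, 1%N; split=> //; first by rewrite !orbT.
  by rewrite muln1 addnAC Eq -mulnSr leq_pmul2l //; rewrite Eq ltn_pmul2l in lt_q.
exists d, 2%N; split=> //; first by rewrite !orbT.
have {}lt_q : (q < s)%N by rewrite Eq ltn_pmul2l in lt_q.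
rewrite addnAC Eq -mulnDr leq_pmul2l // addn2 ltn_neqAle lt_q andbT.
(* If the gap were only [2 ^ d], the first [d] weights would account for the whole degree except
   [2 ^ d], and the next weight would be 1. *)
apply/eqP => Eqs.
have [v e1 e2] := mdeg_wsum d m.
have dv : mdeg v = 1%N.
  apply/eqP; rewrite -(eqn_pmul2l (pow d)) muln1.
  have Es : (s * 2 ^ d = q * 2 ^ d + 2 ^ d)%N by rewrite -Eqs mulSn addnC.
  by move: e1 Eq sd; rewrite dm mulnBr muln1 Es (mulnC q); lia.
have ov : #|oddset v| = 1%N.
  have /mdeg1P[i /eqP ->] : mdeg v == 1%N by rewrite dv.
  rewrite -(cards1 i); congr #|pred_of_set _|; apply/setP => j.
  by rewrite !inE mnm1E eq_sym; case: eqP.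
have [hd|hd] := eqVneq h d; last first.
  have /(leq_wsum m) : (d < h)%N by rewrite ltn_neqAle eq_sym hd.
  rewrite wsum_recr e2 ov; move: e1 lt_w lt_n; rewrite dv dm; lia.
(* An exponent above [d] makes the truncated spike fall short of the degree by at least [2 ^ d],
   contradicting the strict inequality. *)
have /hasP[u ue du] := min_spike_large d0 s2 spk.
have : (\sum_(u <- e) (2 ^ minn u h - 1) + 2 ^ d <= s * (2 ^ d - 1))%N.
  rewrite -se hd; elim: (e) ue => //= w e' IH; rewrite inE big_cons => /orP[/eqP <-|/IH le].
    rewrite (minn_idPr (ltnW du)).
    have le2 : (\sum_(j <- e') (2 ^ minn j d - 1) <= sumn [seq 2 ^ u0 - 1 | u0 <- e'])%N.
      elim: (e') => [|x e'' IH']; first by rewrite big_nil.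
      rewrite big_cons /= leq_add // leq_sub2r // leq_exp2l //; exact: geq_minl.
    have : (2 ^ d.+1 <= 2 ^ u)%N by rewrite leq_exp2l.
    by rewrite expnS; have := pow d; lia.
  rewrite -addnA leq_add // leq_sub2r // leq_exp2l //; exact: geq_minl.
by move: lt_w; rewrite hd; move: e1; rewrite dm dv; lia.
Qed.

(** * Towers of the polynomials [Xij] and spanning modulo hits *)

Section Towers.
Variable k : nat.

Lemma full_set (S : {set 'I_k}) : (k <= #|S|)%N -> S = setT.
Proof. by move=> le_k; apply/eqP; rewrite eqEcard subsetT cardsT card_ord. Qed.

Implicit Types (f g w z : Pk k) (S J : {set 'I_k}) (L : seq (nat * nat)).

Definition wfpair (c : nat * nat) : bool := (c.1 < c.2 < k)%N.

Definition cpair (c : nat * nat) : {set 'I_k} :=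
  [set l : 'I_k | (l != c.1 :> nat) && (l != c.2 :> nat)].

Lemma XijE c : Xij k c.1 c.2 = Yset (cpair c).
Proof. by apply: eq_bigl => l; rewrite inE. Qed.

Lemma XijC i j : Xij k i j = Xij k j i.
Proof. by apply: eq_bigl => l; rewrite andbC. Qed.

Lemma Xij_ord (i j : 'I_k) : Xij k i j = Yset (~: [set i; j]).
Proof. by apply: eq_bigl => l; rewrite !inE negb_or. Qed.

(** The [Sq 1] relations yield index pairs in either order, while the entries of a tower are
    increasing pairs. *)
Definition ordpair (i j : nat) := if (i < j)%N then (i, j) else (j, i).

Lemma Xij_ordpair i j : Xij k i j = Xij k (ordpair i j).1 (ordpair i j).2.
Proof. by rewrite /ordpair; case: ifP => // _; rewrite XijC. Qed.

Lemma wf_ordpair (i j : 'I_k) : i != j -> wfpair (ordpair i j).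
Proof.
rewrite -val_eqE /= neq_ltn /wfpair /ordpair.
by case: (ltnP i j) => [ij _|ji] /=; [rewrite ij ltn_ord|move=> ->; rewrite ltn_ord].
Qed.

Lemma wfpair_ord c : wfpair c -> exists i j : 'I_k, [/\ i != j, c = (val i, val j) & (i < j)%N].
Proof.
case: c => i j /andP[/= ij jk]; exists (Ordinal (ltn_trans ij jk)), (Ordinal jk).
by split=> //; rewrite -val_eqE /= neq_ltn ij.
Qed.

Lemma card_setC2 (i j : 'I_k) : i != j -> (#|~: [set i; j]| + 2 = k)%N.
Proof.
by move=> ij; have := cardsC [set i; j]; rewrite cards2 ij card_ord addnC.
Qed.

Lemma size_enum_neq2 (i j : 'I_k) : i != j ->
  size (enum [pred l : 'I_k | (l != i :> nat) && (l != j :> nat)]) = (k - 2)%N.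
Proof.
move=> ij; have <- : (#|~: [set i; j]| = k - 2)%N.
  by have := card_setC2 ij; move: #|_| => r; lia.
by rewrite -cardE; apply: eq_card => l; rewrite !inE negb_or.
Qed.

Lemma cpair_ord (i j : 'I_k) : cpair (val i, val j) = ~: [set i; j].
Proof. by apply/setP => l; rewrite !inE negb_or. Qed.

Lemma card_cpair c : wfpair c -> (#|cpair c| + 2 = k)%N.
Proof. by move=> /wfpair_ord[i [j [ij -> _]]]; rewrite cpair_ord card_setC2. Qed.

Lemma cpairP J : (#|J| + 2 = k)%N -> exists2 c, wfpair c & J = cpair c.
Proof.
move=> J2; have : #|~: J| == 2%N.
  by have := cardsC J; rewrite card_ord => E; apply/eqP; lia.
case/cards2P => i [j [ij e]].
have eJ : J = ~: [set i; j] by rewrite -e setCK.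
have [lt|gt|eq] := ltngtP i j; last by rewrite (val_inj eq) eqxx in ij.
  by exists (val i, val j); rewrite ?cpair_ord // /wfpair /= lt ltn_ord.
by exists (val j, val i); rewrite ?cpair_ord 1?setUC // /wfpair /= gt ltn_ord.
Qed.

(* [XT L w] is [X_c1 ^ (2 ^ (e - 1)) * ... * X_ce * w ^ (2 ^ e)] for
   [L = [:: c1; ...; ce]]: the head of [L] carries the largest exponent. *)
Definition XT L w : Pk k := foldl (fun acc c => Xij k c.1 c.2 * acc ^+ 2) w L.

Lemma XT_cat L L' w : XT (L ++ L') w = XT L' (XT L w).
Proof. exact: foldl_cat. Qed.

Lemma XT_rcons L c w : XT (rcons L c) w = Xij k c.1 c.2 * XT L w ^+ 2.
Proof. by rewrite -cats1 XT_cat. Qed.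

Lemma XTD L w w' : XT L (w + w') = XT L w + XT L w'.
Proof. by elim: L w w' => //= c L IH w w'; rewrite expp2D mulrDr IH. Qed.

Lemma XT0 L : XT L 0 = 0.
Proof. by elim: L => //= c L IH; rewrite expr0n mulr0 IH. Qed.

Lemma XT_sum L (I : Type) (r : seq I) (P : pred I) (F : I -> Pk k) :
  XT L (\sum_(i <- r | P i) F i) = \sum_(i <- r | P i) XT L (F i).
Proof. exact: (big_morph _ (XTD L) (XT0 L)). Qed.

Lemma XTE L w : XT L w = (\prod_(t < size L) Xij k (nth (0, 0)%N L t).1 (nth (0, 0)%N L t).2
     ^+ (2 ^ (size L - t.+1))) * w ^+ (2 ^ size L).
Proof.
elim/last_ind: L => [|L c IH]; first by rewrite big_ord0 mul1r expr1.
rewrite XT_rcons IH size_rcons big_ord_recr /= nth_rcons ltnn eqxx subnn expr1.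
rewrite exprMn -exprM -expnSr mulrA [in RHS](mulrC _ (Xij _ _ _)); congr (_ * _ * _).
rewrite -prodrXl; apply: eq_bigr => t _; rewrite nth_rcons ltn_ord -exprM -expnSr.
by rewrite subSn.
Qed.

Lemma dhomog_Xij c : wfpair c -> Xij k c.1 c.2 \is (k - 2).-homog.
Proof.
move=> wc; rewrite XijE; have -> : (k - 2 = #|cpair c|)%N by have := card_cpair wc; lia.
exact: dhomog_Yset.
Qed.

Lemma dhomog_XT1 L : all wfpair L -> XT L 1 \is ((k - 2) * (2 ^ size L - 1)).-homog.
Proof.
elim/last_ind: L => [_|L c IH]; first by rewrite muln0 dhomog1.
rewrite all_rcons => /andP[wc /IH h]; rewrite XT_rcons size_rcons expnS.
have -> : ((k - 2) * (2 * 2 ^ size L - 1) =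
           (k - 2) + (k - 2) * (2 ^ size L - 1) * 2)%N.
  by rewrite -mulnA -mulnS; congr muln; have := expn_gt0 2 (size L); lia.
by apply: dhomogM; [apply: dhomog_Xij|apply: dhomogMn].
Qed.

Lemma Sq1_Yset S : Sq 1 (Yset S) = \sum_(l in S) 'X_l * Yset S.
Proof.
have Sq1M p q : Sq 1 (p * q) = Sq 1 p * q + p * Sq 1 q :> Pk k.
  by rewrite SqM big_ord_recl big_ord1 /= !Sq_0 addrC.
rewrite -big_enum -vprod_enum /= /vprod; elim: (enum S) => [|i r IH].
  by rewrite !big_nil SqE rmorph1 coef1.
rewrite !big_cons Sq1M IH Sq_var /= mulr_sumr expr2 mulrA; congr (_ + _).
by apply: eq_bigr => l _; rewrite mulrCA.
Qed.

Lemma Yset_setD1 S i : i \in S -> Yset S = 'X_i * Yset (S :\ i).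
Proof. by move=> iS; rewrite /Yset (big_setD1 i). Qed.

Lemma var_YsetC1 (i l : 'I_k) w : l != i ->
  'X_l * (Yset (~: [set i]) * w ^+ 2) = Xij k i l * ('X_l * w) ^+ 2.
Proof.
move=> li; have -> : Yset (~: [set i]) = 'X_l * Yset (~: [set i; l]).
  rewrite (@Yset_setD1 (~: [set i]) l) ?inE //; congr (_ * Yset _).
  by apply/setP => a; rewrite !inE negb_or andbC.
rewrite Xij_ord; move: (Yset _) ('X_l : Pk k) => a b; ring.
Qed.

(** The sum is [Sq 1] of [z ^+ 2] times the product of all variables except [x_j], because [Sq 1]
    kills squares. *)
Lemma Sq1_relation (j : 'I_k) z D : z \is D.-homog ->
  hitn (k + 2 * D) (\sum_(l | l != j) Xij k l j * ('X_l * z) ^+ 2).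
Proof.
move=> hz; have -> : \sum_(l | l != j) Xij k l j * ('X_l * z) ^+ 2 =
                     Sq 1 (Yset (~: [set j]) * z ^+ 2).
  rewrite SqM big_ord_recl big_ord1 /= Sq_0 (_ : Sq (bump 0 0) _ = Sq 1 (Yset (~: [set j]))) //.
  rewrite Sq_square /= mulr0 add0r Sq_0 Sq1_Yset mulr_suml.
  apply: eq_big => [l|l lj]; first by rewrite !inE.
  rewrite (@Yset_setD1 (~: [set j]) l) ?inE // Xij_ord exprMn.
  have -> : ~: [set j] :\ l = ~: [set l; j] by apply/setP => i; rewrite !inE negb_or.
  by rewrite expr2 !mulrA -!(mulrC (Yset _)) !mulrA.
apply: (@hitn_Sq _ _ _ (#|~: [set j]| + D * 2)) => //.
  by apply: dhomogM; [apply: dhomog_Yset|apply: dhomogMn].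
by have := cardsC [set j]; rewrite cards1 card_ord; lia.
Qed.

Definition spanned (G : Pk k -> Prop) f : Prop :=
  exists l : seq (Pk k), (forall g, g \in l -> G g) /\ hit (f + \sum_(g <- l) g).

Lemma spanned_hit G f : hit f -> spanned G f.
Proof. by move=> h; exists [::]; rewrite big_nil addr0. Qed.

Lemma spanned_gen (G : Pk k -> Prop) f : G f -> spanned G f.
Proof.
move=> Gf; exists [:: f]; rewrite big_seq1 addpp; split; last exact: hit0.
by move=> g; rewrite inE => /eqP ->.
Qed.

Lemma spannedD G f g : spanned G f -> spanned G g -> spanned G (f + g).
Proof.
move=> [l [Gl hl]] [l' [Gl' hl']]; exists (l ++ l'); split.
  by move=> h; rewrite mem_cat => /orP[/Gl|/Gl'].
by rewrite big_cat addrACA; apply: hitD.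
Qed.

Lemma spanned_sum G (I : eqType) (r : seq I) (P : pred I) (F : I -> Pk k) :
  (forall i, i \in r -> P i -> spanned G (F i)) -> spanned G (\sum_(i <- r | P i) F i).
Proof.
move=> H; rewrite big_seq_cond.
by apply: big_ind => [||i /andP[]]; [apply/spanned_hit/hit0|apply: spannedD|apply: H].
Qed.

Lemma spanned_eqv G f g : hit (f + g) -> spanned G g -> spanned G f.
Proof. by move=> h sg; rewrite -(addppK f g); apply: spannedD => //; apply: spanned_hit. Qed.

Lemma spanned_trans (G G' : Pk k -> Prop) f :
  (forall g, G g -> spanned G' g) -> spanned G f -> spanned G' f.
Proof.
move=> GG' [l [Gl hl]]; apply: spanned_eqv hl _.
by apply: spanned_sum => g /Gl /GG'.
Qed.

End Towers.

(** * The kernel of Kameko's operation is spanned by towers *)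

Section Spanning.
Variables (k s M0 : nat).
Hypothesis base : spike_base s M0.
Hypothesis ks : k = s.+2.
Hypothesis sM : (s <= M0)%N.
Implicit Types (f g w : Pk k) (L : seq (nat * nat)).

(** In the theorem, [deg 0] is [m] and [deg d] is [n]. *)
Definition deg e : nat := (2 ^ e * M0 - s)%N.

Lemma degK e : (deg e + s = 2 ^ e * M0)%N.
Proof.
rewrite /deg subnK //; apply: leq_trans sM _.
by rewrite leq_pmull // expn_gt0.
Qed.

Lemma degS e : deg e.+1 = (s + 2 * deg e)%N.
Proof. by have := degK e; have := degK e.+1; rewrite expnS -mulnA; lia. Qed.

Lemma card_cpair_s c : wfpair k c -> #|cpair k c| = s.
Proof. by move=> /card_cpair; move: #|_| => r; lia. Qed.

Lemma dhomog_XijM c w D : wfpair k c -> w \is D.-homog ->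
  Xij k c.1 c.2 * w ^+ 2 \is (s + 2 * D).-homog.
Proof.
move=> wc hw; rewrite mulnC; apply: dhomogM; last exact: dhomogMn.
have <- : (k - 2 = s)%N by lia.
exact: dhomog_Xij.
Qed.

Lemma dhomog_XT e L w : all (wfpair k) L -> w \is (deg e).-homog ->
  XT L w \is (deg (e + size L)).-homog.
Proof.
elim: L e w => [|c L IH] e w /=; first by rewrite addn0.
move=> /andP[wc wL] hw; rewrite addnS -addSn; apply: IH => //.
by rewrite degS; apply: dhomog_XijM.
Qed.

Lemma hitn_XijM e c w : wfpair k c -> hitn (deg e) w ->
  hitn (deg e.+1) (Xij k c.1 c.2 * w ^+ 2).
Proof.
move=> wc hw; rewrite XijE degS.
by apply: (hitn_square base (e := e) (card_cpair_s wc) hw); rewrite -degS degK.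
Qed.

Lemma hitn_XT e L w : all (wfpair k) L -> hitn (deg e) w ->
  hitn (deg (e + size L)) (XT L w).
Proof.
elim: L e w => [|c L IH] e w /=; first by rewrite addn0.
by move=> /andP[wc wL] hw; rewrite addnS -addSn; apply: IH => //; apply: hitn_XijM.
Qed.

Definition tower e g : Prop := exists L (y : 'X_{1..k}),
  [/\ all (wfpair k) L, size L = e, mdeg y = deg 0 & g = XT L 'X_[y]].

Lemma tower_homog e g : tower e g -> g \is (deg e).-homog.
Proof.
move=> [L [y [wL <- dy ->]]]; apply: (@dhomog_XT 0) => //.
by rewrite dhomogX; apply/eqP.
Qed.

Lemma tower_lift e c v : wfpair k c -> v \is (deg e).-homog ->
  spanned (tower e) v -> spanned (tower e.+1) (Xij k c.1 c.2 * v ^+ 2).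
Proof.
move=> wc hv [l [Gl hl]]; exists [seq Xij k c.1 c.2 * g ^+ 2 | g <- l]; split.
  move=> _ /mapP[g /Gl [L [y [wL eL dy ->]]] ->]; exists (rcons L c), y.
  by rewrite all_rcons wc wL size_rcons eL XT_rcons.
rewrite big_map -mulr_sumr -expp2_sum -mulrDr -expp2D.
apply: hitn_hit; apply: (@hitn_XijM e) => //; apply: hit_hitn => //.
by apply: rpredD => //; rewrite big_seq; apply: rpred_sum => g /Gl /tower_homog.
Qed.

(** By parity a monomial of [v] has fewer than [s], exactly [s] or all [k] exponents odd. The first
    case is hit, the second is again some [Xij] times a square, and the third is reduced to the
    second by [Sq1_relation]. *)
Lemma tower_step e c v : wfpair k c -> v \is (deg e).-homog ->
  spanned (tower e.+1) (Xij k c.1 c.2 * v ^+ 2).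
Proof.
elim: e c v => [|e IH] c v wc hv.
  apply: tower_lift => //; rewrite [v]mpolyE_F2.
  apply: spanned_sum => m /(dhomog_mf hv) dm _; apply: spanned_gen.
  by exists [::], m.
rewrite [v]mpolyE_F2 expp2_sum mulr_sumr; apply: spanned_sum => m mv _.
have dm : mdeg m = deg e.+1 by apply: (dhomog_mf hv).
have hm : ('X_[m] : Pk k) \is (deg e.+1).-homog by rewrite dhomogX; apply/eqP.
have Hs (c' : nat * nat) (h : Pk k) : wfpair k c' -> h \is (deg e).-homog ->
    wfpair k c -> spanned (tower e.+2) (Xij k c.1 c.2 * (Xij k c'.1 c'.2 * h ^+ 2) ^+ 2).
  move=> wc' hh wc0; apply: tower_lift => //; last exact: IH.
  by rewrite degS; apply: dhomog_XijM.
have le_m := card_oddset ks m; have := mdeg_split m; rewrite dm => Em.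
have hh : ('X_[halfm m] : Pk k) \is (mdeg (halfm m)).-homog by rewrite dhomogX.
have par : ~~ odd (#|oddset m| + s).
  by move: (degK e.+1); rewrite Em expnS -mulnA; lia.
have [lt_r|ge_r] := ltnP #|oddset m| s.
  apply: spanned_hit; apply: hitn_hit; apply: (@hitn_XijM e.+1) => //.
  rewrite Em mpolyX_split; apply: (hitn_small base (e := e)) => //.
  by rewrite -Em degK.
have [eq_r|ne_r] := eqVneq #|oddset m| s.
  have [c' wc' ec'] : exists2 c', wfpair k c' & oddset m = cpair k c'.
    by apply: cpairP; rewrite eq_r addn2.
  rewrite mpolyX_split ec' -XijE; apply: Hs => //.
  by move: Em; rewrite eq_r degS => /addnI /eqP; rewrite eqn_pmul2l // => /eqP ->.
have eq_k : #|oddset m| = k by move: ge_r ne_r par le_m; move: #|_| => r; lia.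
have eT : oddset m = setT by apply: full_set; rewrite eq_k.
have [i [j [ij ec _]]] := wfpair_ord wc.
(* The monomial is [x_i z], so its term is the one with [l = i] in the relation for [j]. In every
   other term, [x_l z] has exactly [s] odd exponents. *)
set h : Pk k := 'X_[halfm m]; pose z : Pk k := Yset (~: [set i]) * h ^+ 2.
have Xz l : l != i -> 'X_l * z = Xij k i l * ('X_l * h) ^+ 2 by apply: var_YsetC1.
have mz : 'X_[m] = 'X_i * z.
  by rewrite mpolyX_split eT (@Yset_setD1 _ setT i) ?inE // setTD -mulrA.
have deg_h : deg e.+1 = (k + 2 * mdeg (halfm m))%N by rewrite Em eq_k.
have deg_e : deg e = (1 + mdeg (halfm m))%N.
  by move: deg_h; rewrite degS; lia.
have hz : z \is (#|~: [set i]| + mdeg (halfm m) * 2).-homog.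
  by apply: dhomogM; [apply: dhomog_Yset|apply: dhomogMn].
have rel := Sq1_relation j hz.
apply: (@spanned_eqv _ _ _ (\sum_(l | (l != j) && (l != i)) Xij k l j * ('X_l * z) ^+ 2)).
  by move: (hitn_hit rel); rewrite (bigD1 i) //= mz ec.
apply: spanned_sum => l _ /andP[lj li].
rewrite (Xij_ordpair k l j) (Xz l li) (Xij_ordpair k i l).
apply: tower_lift; first exact: wf_ordpair.
  rewrite degS; apply: dhomog_XijM; first by rewrite wf_ordpair // eq_sym.
  rewrite deg_e; apply: dhomogM => //; exact: dhomog_var.
apply: IH; first by rewrite wf_ordpair // eq_sym.
by rewrite deg_e; apply: dhomogM => //; exact: dhomog_var.
Qed.

Lemma tower_Yset e (J : {set 'I_k}) (v : Pk k) D : (#|J| <= s)%N -> v \is D.-homog ->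
  (#|J| + 2 * D = deg e.+1)%N -> spanned (tower e.+1) (Yset J * v ^+ 2).
Proof.
move=> Js hv eD; have [lt|ge] := ltnP #|J| s.
  apply: spanned_hit; apply: hitn_hit; apply: (hitn_small base (e := e) lt hv).
  by rewrite eD degK.
have Es : #|J| = s by apply/eqP; rewrite eqn_leq Js.
have [c wc ->] : exists2 c, wfpair k c & J = cpair k c by apply: cpairP; rewrite Es addn2.
rewrite -XijE; apply: tower_step => //.
by move: eD; rewrite Es degS => /addnI /eqP; rewrite eqn_pmul2l // => /eqP <-.
Qed.

(** The monomials of [f] with all exponents odd add up to [x_1 ... x_k] times the square of
    [kameko f]. As the latter is hit, [square_expand] leaves terms with at most [k - 2] odd
    variables, like the other monomials of [f]. *)
Lemma kernel_tower e f : f \is (deg e.+1).-homog -> hit (kameko f) ->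
  spanned (tower e.+1) f.
Proof.
move=> hf hk; pose ao (m : 'X_{1..k}) := [forall j : 'I_k, odd (m j)].
have aoT m : ao m -> oddset m = setT.
  by move=> /forallP H; apply/setP => j; rewrite !inE H.
rewrite [f]mpolyE_F2 (bigID ao) /=; apply: spannedD; last first.
  apply: spanned_sum => m /(dhomog_mf hf) dm nao; rewrite mpolyX_split.
  have dm' : (#|oddset m| + 2 * mdeg (halfm m) = deg e.+1)%N by rewrite -mdeg_split.
  apply: (tower_Yset _ _ dm'); last by rewrite dhomogX.
  have lt_k : (#|oddset m| < k)%N.
    rewrite ltnNge; apply: contra nao => /full_set eT.
    by apply/forallP => j; have : j \in oddset m by [rewrite eT inE]; rewrite inE.
  move: (degK e.+1) lt_k; rewrite -dm' expnS -mulnA; move: #|_| => r; lia.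
have kE : kameko f = \sum_(m <- msupp f | ao m) 'X_[halfm m].
  rewrite /kameko big_seq_cond [RHS]big_seq_cond; apply: eq_bigr => m /andP[+ _].
  by rewrite mcoeff_msupp => /F2_neq0 ->; rewrite scale1r.
have -> : \sum_(m <- msupp f | ao m) 'X_[m] = Yset setT * kameko f ^+ 2.
  rewrite kE expp2_sum mulr_sumr; apply: eq_bigr => m /aoT E.
  by rewrite mpolyX_split E.
(* A monomial with all exponents odd is needed to read off the degree of [kameko f]; without one,
   [kameko f] is zero. *)
have [/hasP[m0 m0f am0]|/hasPn nao] := boolP (has ao (msupp f)); last first.
  rewrite kE big_seq_cond big1 => [|m /andP[/nao]]; last by move=> /negPf ->.
  by rewrite expr0n mulr0; apply/spanned_hit/hit0.
pose D := mdeg (halfm m0).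
have ED m : m \in msupp f -> ao m -> (k + 2 * mdeg (halfm m) = deg e.+1)%N.
  by move=> /(dhomog_mf hf) dm /aoT E; move: (mdeg_split m); rewrite E cardsT card_ord => <-.
have hkD : kameko f \is D.-homog.
  rewrite kE big_seq_cond; apply: rpred_sum => m /andP[mf am]; rewrite dhomogX.
  apply/eqP; have := ED _ m0f am0; rewrite -(ED _ mf am) => /addnI /eqP.
  by rewrite eqn_pmul2l // => /eqP.
have [d [l [hl -> _]]] := hit_hitn hkD hk.
have Dn : (2 * D < 2 ^ (2 * D))%N by apply: ltn_expl.
have := square_expand setT hl Dn.
set R := \sum_(J | _) _; move=> hR; apply: (@spanned_eqv _ _ _ R).
  by apply: (@hitn_hit _ (#|[set: 'I_k]| + 2 * D)); exists 0.
apply: spanned_sum => J _ /andP[JT oJ].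
have [EJ J2] := proper_card_even JT oJ.
have hZ := square_expand_homog (2 * D) hl (proper_sub JT) oJ.
have := ED _ m0f am0; rewrite -/D => EDk.
move: EJ; rewrite cardsT card_ord => EJ.
apply: (tower_Yset _ hZ); first by move: EJ J2; move: #|J| #|_| => r c; lia.
by rewrite -EDk -[X in (X + 2 * D)%N]EJ; move: J2 oJ; move: #|J| #|_| => r c; lia.
Qed.

(** Squares below [2 ^ d0] commute with multiplication by the power of [g], and that power leaves
    the first [d0] weights unchanged; so the three parts follow from [Sq_mulr_expr2n], [low_weight]
    and [weight_criterion]. *)
Lemma rel_hitn d0 e f g : (0 < d0)%N -> inRel d0 f ->
  f \is (s * (2 ^ d0 - 1)).-homog -> g \is (deg e).-homog ->
  hitn (deg (e + d0)) (f * g ^+ (2 ^ d0)).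
Proof.
move=> d00 [a [b [c [ef [ha [hb hc]]]]]] hf hg.
have k2 : (k - 2 = s)%N by lia.
have sd : (s <= s * 2 ^ d0)%N by rewrite leq_pmulr // expn_gt0.
have degE : (s * (2 ^ d0 - 1) + deg e * 2 ^ d0 = deg (e + d0))%N.
  have := degK (e + d0); rewrite addnC expnD -mulnA.
  have := congr1 (muln (2 ^ d0)) (degK e); rewrite mulnDr mulnBr muln1.
  by rewrite (mulnC (deg e)) (mulnC s) in sd *; lia.
have wd : wdeg (nseq d0 s) = (s * (2 ^ d0 - 1))%N.
  rewrite /wdeg size_nseq.
  transitivity (\sum_(i < d0) 2 ^ i * s)%N.
    by apply: eq_bigr => i _; rewrite nth_nseq ltn_ord.
  rewrite -big_distrl /= mulnC; congr muln.
  elim: (d0) => [|n IH]; first by rewrite big_ord0.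
  by rewrite big_ord_recr /= IH expnS; have := expn_gt0 2 n; lia.
have hbh : b \is (s * (2 ^ d0 - 1)).-homog.
  by apply/dhomogP => y /hb[]; rewrite k2 wd.
have hch : c \is (s * (2 ^ d0 - 1)).-homog.
  by apply/dhomogP => y /hc[]; rewrite k2.
have hgX : g ^+ (2 ^ d0) \is (deg e * 2 ^ d0).-homog by apply: dhomogMn.
have expand (p : Pk k) : (forall y y', y \in msupp p -> y' \in msupp g ->
      hitn (deg (e + d0)) ('X_[(y + y' *+ (2 ^ d0))%MM] : Pk k)) ->
    hitn (deg (e + d0)) (p * g ^+ (2 ^ d0)).
  move=> H; rewrite [p]mpolyE_F2 [g]mpolyE_F2 expp2Xn_sum mulr_suml.
  apply: hitn_sum => y yp _; rewrite mulr_sumr; apply: hitn_sum => y' yg _.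
  by rewrite mpolyXn -mpolyXD; apply: H.
have mdegP y y' : mdeg y = (s * (2 ^ d0 - 1))%N -> y' \in msupp g ->
    mdeg (y + y' *+ (2 ^ d0))%MM = deg (e + d0).
  by move=> dy /(dhomog_mf hg) /= dy'; rewrite mdegD mdegMn dy -degE; congr (_ + _ * _)%N.
rewrite ef !mulrDl; apply: hitnD; first apply: hitnD.
- apply: hit_hitn.
    rewrite -degE; apply: dhomogM => //.
    have -> : a = f + (b + c) by rewrite ef -(addrA a) addppK.
    by apply: rpredD => //; apply: rpredD.
  case: ha => l [hl ->]; rewrite mulr_suml; apply: hit_sum => x /hl /andP[x0 xd] _.
  by rewrite -Sq_mulr_expr2n //; apply: hit_Sq.
- apply: expand => y y' /hb[]; rewrite k2 wd => dy [i [wi lt_i]] yg.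
  have id : (i < d0)%N by move: lt_i; rewrite nth_nseq; case: ifP.
  rewrite -(mdegP _ _ dy yg); apply: (low_weight base ks (i := i) (e := e + d0)).
  + by rewrite (mdegP _ _ dy yg) degK.
  + by rewrite ltn_addl.
  + by move=> j ji; rewrite omega_addXn ?(ltn_trans ji) // wi // nth_nseq (ltn_trans ji).
  + by rewrite omega_addXn //; move: lt_i; rewrite nth_nseq id.
- apply: expand => y y' /hc[]; rewrite k2 => dy [es [spk [h [h0 lt_h]]]] yg.
  have [h' [c' [h'd c0 Hc Hw]]] := Pkn_weight d00 dy spk lt_h.
  rewrite -(mdegP _ _ dy yg); apply: ((weight_criterion base ks h').1 (e + d0) _ c') => //.
  + by rewrite (mdegP _ _ dy yg) degK.
  + exact: leq_trans h'd (leq_addl _ _).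
  + case/or3P: Hc => [lt|->|->]; rewrite ?orbT //.
    by rewrite (leq_trans lt (leq_addl _ _)).
  + by rewrite wsum_addXn.
Qed.

End Spanning.

(** * Normalising towers by sliding windows *)

Lemma smin_le (t : seq nat) x : x \in t -> (smin t <= x)%N.
Proof.
rewrite /smin; move: (head _ _) => a; elim: t => //= y t IH.
by rewrite inE => /orP[/eqP <-|/IH]; [apply: geq_minl|apply: leq_trans (geq_minr _ _)].
Qed.

Lemma smin_sorted a (t : seq nat) : sorted leq (a :: t) -> smin (a :: t) = a.
Proof.
move=> /= /(order_path_min leq_trans) /allP Ha; rewrite /smin /=.
apply/minn_idPl; elim: t Ha => //= b t IH Ha.
rewrite leq_min Ha ?mem_head //=; apply: IH => x xt; apply: Ha.
by rewrite inE xt orbT.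
Qed.

(** The bound on the reduced length says that the first block has length at least 2, and in an
    increasing sequence this block consists of minima. *)
Lemma sorted_rl_head (t : seq nat) : sorted leq t -> (1 < size t)%N ->
  (rl t <= size t - 2)%N -> exists r, t = [:: smin t, smin t & r].
Proof.
case: t => [|a [|b t]] // st _ rlt; rewrite (smin_sorted st); exists t.
move: rlt; rewrite /rl /= eqxx /=; case: eqP => [-> //|_] /=.
by rewrite subSS subn0 !subSS subn0 ltnn.
Qed.

Section Windows.
Variables (k s M0 d0 : nat) (B : {set pairT k d0}).
Hypothesis base : spike_base s M0.
Hypothesis ks : k = s.+2.
Hypothesis sM : (s <= M0)%N.
Hypothesis d02 : (2 < d0)%N.
Hypothesis Binc : forall p, p \in B -> inPInc p.
Hypothesis Bcomp : compatible B.
Implicit Types (p : pairT k d0) (L W R A : seq (nat * nat)) (y : 'X_{1..k}).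

Definition zipp p : seq (nat * nat) := zip (map val p.1) (map val p.2).

Lemma size_zipp p : size (zipp p) = d0.
Proof. by rewrite size_zip !size_map !size_tuple minnn. Qed.

Lemma nth_zipp p (t : 'I_d0) :
  nth (0, 0)%N (zipp p) t = (val (tnth p.1 t), val (tnth p.2 t)).
Proof.
have k0 : (0 < k)%N by rewrite ks.
rewrite nth_zip ?size_map ?size_tuple // !(nth_map (Ordinal k0)) ?size_tuple //.
by rewrite -!tnth_nth.
Qed.

Lemma XT_zipp p (g : Pk k) : XT (zipp p) g = XIJ p * g ^+ (2 ^ d0).
Proof.
rewrite XTE size_zipp; congr (_ * _).
by apply: eq_bigr => t _; rewrite nth_zipp.
Qed.

Lemma wf_zipp p : inPSeq p -> all (wfpair k) (zipp p).
Proof.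
move=> /forallP H; apply/(all_nthP (0, 0)%N) => t; rewrite size_zipp => td.
rewrite -[t]/(val (Ordinal td)) nth_zipp /wfpair /= ltn_ord andbT; exact: H.
Qed.

Lemma wf_zippB p : p \in B -> all (wfpair k) (zipp p).
Proof. by move=> /Binc /andP[]; move/wf_zipp. Qed.

Lemma zipp_surj W : size W = d0 -> all (wfpair k) W ->
  exists2 p, inPSeq p & zipp p = W.
Proof.
move=> sW /(all_nthP (0, 0)%N) wW; have k0 : (0 < k)%N by rewrite ks.
pose o : 'I_k := Ordinal k0.
pose p : pairT k d0 := ([tuple insubd o (nth (0, 0)%N W t).1 | t < d0],
                        [tuple insubd o (nth (0, 0)%N W t).2 | t < d0]).
have E t : (t < d0)%N -> nth (0, 0)%N (zipp p) t = nth (0, 0)%N W t.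
  move=> td; rewrite -[t]/(val (Ordinal td)) nth_zipp !tnth_mktuple /=.
  have := wW t; rewrite sW => /(_ td) /andP[c12 c2].
  by rewrite !val_insubd c2 (ltn_trans c12 c2); case: nth.
exists p; last by apply: (eq_from_nth (x0 := (0, 0)%N)); rewrite size_zipp ?sW.
apply/forallP => t; have := wW t; rewrite sW ltn_ord => /(_ isT).
by rewrite -E ?ltn_ord // nth_zipp => /andP[].
Qed.

Lemma tmin_zipp p : tmin p.1 = smin (unzip1 (zipp p)) /\ tmin p.2 = smin (unzip2 (zipp p)).
Proof. by rewrite unzip1_zip ?unzip2_zip // !size_map !size_tuple. Qed.

Lemma zippB p : p \in B -> exists2 r,
  zipp p = [:: (tmin p.1, tmin p.2), (tmin p.1, tmin p.2) & r] & (size r + 2 = d0)%N.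
Proof.
move=> pB; have /andP[_ /andP[s1 s2]] := Binc pB; have [r1 r2] := Bcomp.1 p pB.
have sz (t : d0.-tuple 'I_k) : size (map val t) = d0 by rewrite size_map size_tuple.
have := sorted_rl_head s1; rewrite sz => /(_ (ltnW d02) r1)[t1 e1].
have := sorted_rl_head s2; rewrite sz => /(_ (ltnW d02) r2)[t2 e2].
have e : zipp p = [:: (tmin p.1, tmin p.2), (tmin p.1, tmin p.2) & zip t1 t2].
  by rewrite /zipp e1 e2.
by exists (zip t1 t2) => //; have := size_zipp p; rewrite e /= addn2.
Qed.

Lemma wf_tmin p : p \in B -> wfpair k (tmin p.1, tmin p.2).
Proof. by move=> pB; have [r e _] := zippB pB; have := wf_zippB pB; rewrite e => /andP[]. Qed.

Lemma dhomog_mono y : mdeg y = deg s M0 0 -> ('X_[y] : Pk k) \is (deg s M0 0).-homog.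
Proof. by move=> dy; rewrite dhomogX; apply/eqP. Qed.

Lemma dhomog_XIJ p : inPSeq p -> XIJ p \is (s * (2 ^ d0 - 1)).-homog.
Proof.
move=> /wf_zipp wp; have := dhomog_XT1 wp; rewrite XT_zipp expr1n mulr1 size_zipp.
by have -> : (k - 2 = s)%N by lia.
Qed.

(** Compatibility rewrites the window [W]: the entries [L1] with larger exponents are absorbed into
    the power of [g] in [rel_hitn], and the entries [L2] are put back by [hitn_XT]. *)
Lemma window (G : Pk k -> Prop) L1 W L2 y :
  all (wfpair k) (L1 ++ W ++ L2) -> size W = d0 -> mdeg y = deg s M0 0 ->
  (forall p, p \in B -> (tmin p.1 <= smin (unzip1 W))%N -> (tmin p.2 <= smin (unzip2 W))%N ->
     spanned G (XT (L1 ++ zipp p ++ L2) 'X_[y])) ->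
  spanned G (XT (L1 ++ W ++ L2) 'X_[y]).
Proof.
rewrite !all_cat => /and3P[w1 wW w2] sW dy H.
have [HK hHK eW] := zipp_surj sW wW.
have [Bu [BuB [Bumin rel]]] := Bcomp.2 HK hHK.
set F := XIJ HK + _ in rel.
pose g : Pk k := XT L1 'X_[y].
have hg : g \is (deg s M0 (0 + size L1)).-homog.
  by apply: (dhomog_XT ks sM w1); apply: dhomog_mono.
have hF : F \is (s * (2 ^ d0 - 1)).-homog.
  apply: rpredD; first exact: dhomog_XIJ.
  apply: rpred_sum => u _; apply: rpred_sum => p pBu; apply: dhomog_XIJ.
  by case/andP: (Binc (subsetP (BuB u) p pBu)).
have := hitn_XT base ks sM w2 (rel_hitn base ks sM (ltnW (ltnW d02)) rel hF hg).
move=> /hitn_hit.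
rewrite /F mulrDl -XT_zipp eW XTD mulr_suml XT_sum => h.
rewrite !XT_cat -/g; apply: (spanned_eqv h).
rewrite big_nat; apply: spanned_sum => u _ /andP[_]; rewrite ltnS => le_u.
rewrite mulr_suml XT_sum; apply: spanned_sum => p _ pBu.
rewrite -XT_zipp /g -!XT_cat.
have [m1 m2] := Bumin u p pBu.
have [t1 t2] := tmin_zipp HK.
apply: H; first exact: (subsetP (BuB u)).
  by rewrite m1 t1 eW.
by rewrite m2 -eW -t2.
Qed.

Variable d : nat.

(** The monomial [y] is not yet required to be admissible. *)
Definition genp (g : Pk k) : Prop := exists p (y : 'X_{1..(k - 2)%N}),
  [/\ p \in B, mdeg y = deg s M0 0 & g = gen d p y].

Definition normalizes (sg : nat) : Prop := forall p R y,
  p \in B -> (tmin p.1 + tmin p.2 = sg)%N -> all (wfpair k) R ->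
  (size R + d0 = d)%N -> mdeg y = deg s M0 0 ->
  spanned genp (XT (zipp p ++ R) 'X_[y]).

(** Shift the window one entry towards the front: it still contains the pair of minima of [p], so
    neither minimum increases. Repeating this uses up [A]. *)
Lemma bubble sg A p R y : (forall sg', (sg' <= sg)%N -> normalizes sg') ->
  p \in B -> (tmin p.1 + tmin p.2 <= sg)%N -> all (wfpair k) A -> all (wfpair k) R ->
  (size A + d0 + size R = d)%N -> mdeg y = deg s M0 0 ->
  spanned genp (XT (A ++ zipp p ++ R) 'X_[y]).
Proof.
move=> HN; elim/last_ind: A p R => [|A a IH] p R pB sgp wA wR sz dy.
  by apply: (HN _ sgp) => //; rewrite addnC -[X in _ = X]sz.
move: wA; rewrite all_rcons => /andP[wa wA].
have [r e sr] := zippB pB; set c := (tmin p.1, tmin p.2) in e.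
have wz := wf_zippB pB.
have -> : rcons A a ++ zipp p ++ R =
    A ++ (a :: take d0.-1 (zipp p)) ++ (drop d0.-1 (zipp p) ++ R).
  by rewrite -cats1 -catA /= (catA (take _ _)) cat_take_drop.
move: (wz); rewrite -{1}(cat_take_drop d0.-1 (zipp p)) all_cat => /andP[wz1 wz2].
have cW : c \in a :: take d0.-1 (zipp p).
  have -> : d0.-1 = (size r).+1 by lia.
  by rewrite e /= !inE eqxx orbT.
apply: window => //.
- by rewrite !all_cat /= wA wa wz1 wz2 wR.
- by rewrite /= size_takel ?size_zipp; move: d02; clear; lia.
move=> p' p'B le1 le2; apply: IH => //.
- have := leq_trans le1 (smin_le (map_f fst cW)).
  have := leq_trans le2 (smin_le (map_f snd cW)).
  by move=> /= h1 h2; apply: leq_trans sgp; rewrite leq_add.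
- by rewrite all_cat wz2 wR.
- by rewrite size_cat size_drop size_zipp; move: d02 sz; rewrite size_rcons; clear; lia.
Qed.

Lemma XT_nseq q c (w : Pk k) :
  XT (nseq q c) w = Xij k c.1 c.2 ^+ (2 ^ q - 1) * w ^+ (2 ^ q).
Proof.
elim: q => [|q IH]; first by rewrite mul1r.
have -> : nseq q.+1 c = rcons (nseq q c) c.
  by have := nseqD q 1 c; rewrite addn1 cats1.
rewrite XT_rcons IH exprMn -!exprM mulrA -exprS -expnSr.
by congr (_ ^+ _ * _); rewrite expnSr; move: (expn_gt0 2 q); clear; lia.
Qed.

(** A generator is the tower of [p] preceded by copies of its pair of minima; the copies contribute
    the exponent [(2 ^ q - 1) 2 ^ d0]. *)
Lemma gen_XT q p (w : Pk k) :
  XT (nseq q (tmin p.1, tmin p.2) ++ zipp p) w =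
  XIJ p * Xij k (tmin p.1) (tmin p.2) ^+ (2 ^ (q + d0) - 2 ^ d0) * w ^+ (2 ^ (q + d0)).
Proof.
rewrite XT_cat XT_zipp XT_nseq /= exprMn -!exprM mulrA.
by rewrite mulnBl mul1n -!expnD.
Qed.

Lemma fij_mono (i j : 'I_k) y : i != j -> y i = 0%N -> y j = 0%N ->
  exists2 y' : 'X_{1..(k - 2)%N}, mdeg y' = mdeg y & fij (k := k) i j 'X_[y'] = 'X_[y].
Proof.
move=> ij yi yj; set E := enum [pred l : 'I_k | (l != i :> nat) && (l != j :> nat)].
have sE : size E = (k - 2)%N by apply: size_enum_neq2.
have outE (l : 'I_k) : l \notin E -> y l = 0%N.
  rewrite mem_enum inE negb_and !negbK !val_eqE.
  by case/orP => /eqP ->.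
pose y' : 'X_{1..(k - 2)%N} := [multinom y (nth i E t) | t < k - 2].
have uE : uniq E by apply: enum_uniq.
exists y'.
  rewrite !mdegE (eq_bigr (fun t : 'I_(k - 2) => y (nth i E t))); last by move=> t _; rewrite mnmE.
  rewrite -(big_mkord xpredT (fun t => y (nth i E t))) -sE -(big_nth i xpredT y).
  rewrite /E big_enum /= [RHS](bigID (mem E)) /= [X in (_ + X)%N]big1.
    by rewrite addn0; apply: eq_bigl => l; rewrite mem_enum.
  exact: outE.
rewrite /fij comp_mpolyX mpolyXE_id.
transitivity (\prod_(t < k - 2) ('X_(nth i E t) : Pk k) ^+ y (nth i E t)).
  apply: eq_bigr => t _; rewrite tnth_mktuple mnmE (nth_map i) //.
  by rewrite -/E sE ltn_ord.
rewrite -(big_mkord xpredT (fun t => ('X_(nth i E t) : Pk k) ^+ y (nth i E t))).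
rewrite -sE -(big_nth i xpredT (fun l => ('X_l : Pk k) ^+ y l)).
rewrite /E big_enum /= [RHS](bigID (mem E)) /= [X in _ * X]big1.
  by rewrite mulr1; apply: eq_bigl => l; rewrite mem_enum.
by move=> l lE; rewrite outE ?expr0.
Qed.

Lemma mpolyX_U1 (a : 'I_k) y : (0 < y a)%N -> 'X_[y] = 'X_a * 'X_[(y - U_(a))%MM] :> Pk k.
Proof.
move=> ya; rewrite -mpolyXD addmC submK //.
by rewrite lep1mP -lt0n.
Qed.

(** With [y = x_a y0], the term [l = a] of [Sq1_relation] for [b] and [y0] is the given one. The
    relation is carried through the outer entries [T] by [hitn_XT]. *)
Lemma reduce_var (G : Pk k -> Prop) (a b : 'I_k) T y :
  a != b -> (0 < y a)%N -> mdeg y = deg s M0 0 -> all (wfpair k) T ->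
  (forall l : 'I_k, l != a -> l != b ->
     spanned G (XT (ordpair l b :: T) 'X_[(U_(l) + (y - U_(a)))%MM])) ->
  spanned G (XT T (Xij k a b * 'X_[y] ^+ 2)).
Proof.
move=> ab ya dy wT H; set y0 := (y - U_(a))%MM in H *.
have dy0 : (mdeg y0 + 1 = deg s M0 0)%N.
  rewrite -dy -(mdeg1 a) -mdegD submK //.
  by rewrite lep1mP -lt0n.
have hy0 : ('X_[y0] : Pk k) \is (mdeg y0).-homog by rewrite dhomogX.
have := Sq1_relation b hy0.
have -> : (k + 2 * mdeg y0 = deg s M0 1)%N.
  by rewrite (degS ks sM); lia.
move=> /(hitn_XT base ks sM wT) /hitn_hit.
rewrite XT_sum (bigD1 a) //= -mpolyX_U1 // => h; apply: (spanned_eqv h).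
apply: spanned_sum => l _ /andP[lb la].
by have := H l la lb; rewrite /= -Xij_ordpair mpolyXD.
Qed.

(** Three nested inductions: on the sum of the minima [i] and [j], on the exponents of [x_i] and
    [x_j] in [y], and on the entries [R] not yet reached by the window. *)
Lemma normalize sg : (d0 <= d)%N -> normalizes sg.
Proof.
move=> d0d; elim/ltn_ind: sg => sg IHs.
have bub A p R y : p \in B -> (tmin p.1 + tmin p.2 < sg)%N -> all (wfpair k) A ->
    all (wfpair k) R -> (size A + d0 + size R = d)%N -> mdeg y = deg s M0 0 ->
    spanned genp (XT (A ++ zipp p ++ R) 'X_[y]).
  move=> pB lt_p wA wR sz dy; apply: (@bubble sg.-1) => //; last by move: lt_p; clear; lia.
  by move=> sg' le_sg; apply: IHs; move: lt_p le_sg; clear; lia.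
move=> p0 R0 y0 p0B sg0 wR0 sz0 dy0.
set c := (tmin p0.1, tmin p0.2); have wc : wfpair k c by apply: wf_tmin.
have [i [j [ij ec ltij]]] := wfpair_ord wc.
have same p : p \in B -> (tmin p.1 <= c.1)%N -> (tmin p.2 <= c.2)%N ->
    (tmin p.1 + tmin p.2 < sg)%N \/ (tmin p.1, tmin p.2) = c.
  move=> pB le1 le2; have [lt|ge] := ltnP (tmin p.1 + tmin p.2) sg; [by left|right].
  by rewrite /c in le1 le2 *; move: le1 le2 ge; rewrite -sg0 /=; clear=> *; congr (_, _); lia.
suff : forall n y, (y i + y j < n)%N -> mdeg y = deg s M0 0 ->
    forall R q p, p \in B -> (tmin p.1, tmin p.2) = c -> all (wfpair k) R ->
    (q + d0 + size R = d)%N -> spanned genp (XT (nseq q c ++ zipp p ++ R) 'X_[y]).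
  by move/(_ _ y0 (ltnSn _) dy0 R0 0%N p0); apply=> //; rewrite -sz0 addnC.
elim=> // n IHn y lt_y dy; elim=> [|c0 R IHR] q p pB ep wR sz.
  have wnp : all (wfpair k) (nseq q c ++ zipp p).
    by rewrite all_cat wf_zippB // andbT; apply/allP => x /nseqP[-> _].
  rewrite cats0; move: sz; rewrite addn0 => sz.
  (* The first entry is about to be changed by [reduce_var]. A further copy of [c] stays in the
     front window and keeps the minima from increasing. *)
  have [T [eT cT wT sT]] : exists T, [/\ nseq q c ++ zipp p = c :: T,
      c \in take d0.-1 T, all (wfpair k) T & (size T).+1 = d].
    have [r er sr] := zippB pB; rewrite ep in er.
    have := wnp; have : size (nseq q c ++ zipp p) = d.
      by rewrite size_cat size_nseq size_zipp sz.
    case: q {wnp sz} => [|q]; rewrite ?er.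
      move=> /= sT /andP[_ wT]; exists (c :: r); split=> //.
      by case: (d0) d02 => [|[|[|n0]]] //= _; rewrite mem_head.
    move=> /= sT /andP[_ wT]; exists (nseq q c ++ [:: c, c & r]); split=> //.
    by case: (d0) d02 => [|[|[|n0]]] //= _; case: (q) => [|q'] /=; rewrite mem_head.
  have step (a b : 'I_k) : a != b -> Xij k a b = Xij k c.1 c.2 ->
      (forall z : 'X_{1..k}, z a + z b = z i + z j)%N -> (0 < y a)%N ->
      spanned genp (XT (nseq q c ++ zipp p) 'X_[y]).
    move=> ab eX yab ya; rewrite eT /= -eX.
    apply: reduce_var => // l la lb; set y1 := (_ + _)%MM.
    have dy1 : mdeg y1 = deg s M0 0.
      by rewrite mdegD mdeg1 addnC -(mdeg1 a) -mdegD submK // lep1mP -lt0n.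
    (* The new variable [x_l] is neither [x_i] nor [x_j], so one factor is lost. *)
    have lt1 : (y1 i + y1 j < n)%N.
      move: lt_y ya; rewrite -!yab !mnmDE !mnmBE !mnm1E.
      by rewrite (negPf la) (negPf lb) eqxx (negPf ab); clear; lia.
    rewrite -[T](cat_take_drop d0.-1) -cat_cons -[_ ++ drop _ _]/([::] ++ _).
    apply: window => //.
    + by rewrite /= wf_ordpair //= cat_take_drop.
    + by rewrite /= size_takel; move: sT d0d d02; clear; lia.
    move=> p' p'B le1 le2.
    have cW : c \in ordpair l b :: take d0.-1 T by rewrite inE cT orbT.
    have wD : all (wfpair k) (drop d0.-1 T) by apply/allP => x /mem_drop /(allP wT).
    have [lt|ep'] := same p' p'B (leq_trans le1 (smin_le (map_f fst cW)))
                            (leq_trans le2 (smin_le (map_f snd cW))).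
      by apply: bub => //; rewrite /= size_drop; move: sT d0d d02; clear; lia.
    rewrite cat0s -[zipp p' ++ _]/(nseq 0 c ++ _); apply: IHn => //.
    by rewrite size_drop; move: sT d0d d02; clear; lia.
  have [y0i|yi] := posnP (y i); last by apply: (step i j) => //; rewrite ec.
  have [y0j|yj] := posnP (y j); last first.
    apply: (step j i) => //; first by rewrite eq_sym.
      by rewrite XijC ec.
    by move=> z; rewrite addnC.
  have [y' dy' ey'] := fij_mono ij y0i y0j.
  apply: spanned_gen; exists p, y'; split=> //; first by rewrite dy'.
  rewrite -ep gen_XT // /gen; have [e1 e2] : tmin p.1 = i /\ tmin p.2 = j.
    by move: ep; rewrite ec => -[-> ->].
  by rewrite sz e1 e2 ey'.
have [r er sr] := zippB pB; rewrite ep in er.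
move: wR => /= /andP[wc0 wR].
have wz := wf_zippB pB.
(* The window moves one entry on: it releases the first [c] and takes in [c0], and the second [c]
   bounds the new minima. Either their sum drops or one more [c] is in place. *)
have -> : nseq q c ++ zipp p ++ c0 :: R = nseq q.+1 c ++ rcons (c :: r) c0 ++ R.
  rewrite er -cats1 -catA /= -[nseq q c ++ _]/(nseq q c ++ ([:: c] ++ _)) catA.
  by have := nseqD q 1 c; rewrite addn1 => <-.
have wn : all (wfpair k) (nseq q.+1 c) by apply/allP => x /nseqP[-> _].
apply: window => //.
- move: wz; rewrite er !all_cat all_rcons wn wR wc0 /= => /and3P[-> _ ->] //.
- by rewrite size_rcons /=; move: sr; clear; lia.
move=> p' p'B le1 le2.
have cW : c \in rcons (c :: r) c0 by rewrite mem_rcons !inE eqxx orbT.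
have sz' : (q.+1 + d0 + size R = d)%N by move: sz => /=; clear; lia.
have [lt|ep'] := same p' p'B (leq_trans le1 (smin_le (map_f fst cW)))
                            (leq_trans le2 (smin_le (map_f snd cW))).
  by apply: bub => //; rewrite size_nseq.
exact: IHR.
Qed.

Lemma tower_gen f : (d0 <= d)%N -> tower s M0 d f -> spanned genp f.
Proof.
move=> d0d [L [y [wL sL dy ->]]].
rewrite -[L](cat_take_drop d0) -[_ ++ drop _ _]/([::] ++ _).
apply: window => //; first by rewrite /= cat_take_drop.
  by rewrite size_takel // sL.
move=> p pB _ _; apply: (normalize d0d pB (erefl _)) => //.
  by apply/allP => x /mem_drop /(allP wL).
by rewrite size_drop sL subnK.
Qed.

End Windows.

(** * Reduction to admissible monomials *)

Section Admissible.
Variable k : nat.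
Implicit Types x y z : 'X_{1..k}.

Lemma wlt_irr w : ~ wlt w w.
Proof. by move=> [i [_]]; rewrite ltnn. Qed.

Lemma wlt_trans w1 w2 w3 : wlt w1 w2 -> wlt w2 w3 -> wlt w1 w3.
Proof.
move=> [i [ei lti]] [j [ej ltj]]; exists (minn i j); split.
  by move=> l; rewrite leq_min => /andP[li lj]; rewrite ei // ej.
case: (ltngtP i j) => [ij|ji|ij]; first by rewrite -ej.
  by rewrite ei.
by rewrite -ij in ltj; apply: ltn_trans ltj.
Qed.

Lemma slt_irr x : ~ slt x x.
Proof. by move=> [i [_]]; rewrite ltnn. Qed.

Lemma slt_trans x y z : slt x y -> slt y z -> slt x z.
Proof.
move=> [i [ei lti]] [j [ej ltj]]; case: (ltngtP i j) => [ij|ji|ij].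
- by exists i; split; [move=> l li; rewrite ei // ej // (ltn_trans li)|rewrite -ej].
- by exists j; split; [move=> l lj; rewrite ei ?ej // (ltn_trans lj)|rewrite ei].
- have {}ij := val_inj ij; subst j; exists i; split; last exact: ltn_trans ltj.
  by move=> l li; rewrite ei // ej.
Qed.

Lemma wlt_ext w1 w1' w2 w2' : w1 =1 w1' -> w2 =1 w2' -> wlt w1 w2 -> wlt w1' w2'.
Proof.
move=> e1 e2 [i [ei lti]]; exists i; rewrite -e1 -e2; split=> // j ji.
by rewrite -e1 -e2 ei.
Qed.

Lemma mlt_irr x : ~ mlt x x.
Proof. by move=> [_ [/wlt_irr|[_ /slt_irr]]]. Qed.

Lemma mlt_trans x y z : mlt x y -> mlt y z -> mlt x z.
Proof.
move=> [exy oxy] [eyz oyz]; split; first by rewrite exy.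
case: oxy oyz => [wxy|[oxy sxy]] [wyz|[oyz syz]].
- by left; apply: wlt_trans wyz.
- by left; apply: wlt_ext wxy.
- by left; apply: wlt_ext wyz.
- by right; split=> [i|]; [rewrite oxy|apply: slt_trans syz].
Qed.

Lemma admissible_span x : exists l : seq 'X_{1..k},
  (forall y, y \in l -> mdeg y = mdeg x /\ admissible y) /\
  hit ('X_[x] + \sum_(y <- l) 'X_[y]).
Proof.
pose D := mdeg x; have: mdeg x = D by []; move: D => D dx.
(* Only finitely many monomials have bounded degree, so the number of smaller ones serves as the
   measure for the descent. *)
pose below x : {set 'X_{1..k < D.+1}} := [set z : 'X_{1..k < D.+1} | Defs.decP (mlt z x)].
have [n le_n] := ubnP #|below x|; elim: n => // n IH in x dx le_n *.
have [adm|inadm] := excluded_middle_informative (admissible x).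
  exists [:: x]; rewrite big_seq1 addpp; split; last exact: hit0.
  by move=> y; rewrite inE => /eqP ->.
have {inadm}[q [qx hq]] : inadmissible x.
  by case: (excluded_middle_informative (inadmissible x)).
suff [l [Hl hl]] : exists l : seq 'X_{1..k}, (forall y, y \in l -> mdeg y = mdeg x /\ admissible y) /\
    hit (q + \sum_(y <- l) 'X_[y]).
  exists l; split=> //.
  have -> : 'X_[x] + \sum_(y <- l) 'X_[y] = ('X_[x] + q) + (q + \sum_(y <- l) 'X_[y]).
    by rewrite addrA addppK.
  exact: hitD.
apply: (@mpoly_ind_supp k (fun q => exists l : seq 'X_{1..k},
    (forall y, y \in l -> mdeg y = mdeg x /\ admissible y) /\
    hit (q + \sum_(y <- l) 'X_[y]))).
- by exists [::]; rewrite big_nil addr0; split=> //; apply: hit0.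
- move=> p r [l [Hl hl]] [l' [Hl' hl']]; exists (l ++ l'); split.
    by move=> y; rewrite mem_cat => /orP[/Hl|/Hl'].
  by rewrite big_cat addrACA; apply: hitD.
move=> y /qx yx; have dy : mdeg y = D by rewrite yx.1.
rewrite -yx.1.
apply: IH => //; apply: leq_trans (_ : (#|below x| <= n)%N); last by [].
apply: proper_card; apply/properP; split.
  by apply/subsetP => z; rewrite !inE => /decPP zy; apply/decPP; apply: mlt_trans yx.
have yD : (mdeg y < D.+1)%N by rewrite dy.
exists (BMultinom yD); rewrite !inE; first exact/decPP.
by apply/negP => /decPP /mlt_irr.
Qed.

End Admissible.

(** * Spanning families and dimensions *)

Section MaskSums.
Variable k : nat.
Implicit Types (g : Pk k) (r l : seq (Pk k)).

(** Over two elements, adding a member of the family toggles its bit, so sums with repetitions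
    reduce to the subfamily sums of [spanN]. *)
Lemma mask_toggle g r (b : bitseq) : g \in r -> size b = size r ->
  exists b' : bitseq, size b' = size r /\
    \sum_(h <- mask b' r) h = g + \sum_(h <- mask b r) h.
Proof.
elim: r b => // x r IH [//|c b]; rewrite inE => + /= [sb].
have [-> _|_ /= gr] := eqVneq g x.
  exists (~~ c :: b); split; first by rewrite /= sb.
  by case: c; rewrite /= ?big_cons // addrA addpp add0r.
have [b' [sb' eb']] := IH b gr sb; exists (c :: b'); split; first by rewrite /= sb'.
by case: c; rewrite /= ?big_cons eb' // addrCA.
Qed.

Lemma mask_sum r l : (forall g, g \in l -> g \in r) ->
  exists b : bitseq, size b = size r /\ \sum_(h <- l) h = \sum_(h <- mask b r) h.
Proof.
elim: l => [|g l IH] H.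
  by exists (nseq (size r) false); rewrite size_nseq mask_false !big_nil.
have [b [sb eb]] := IH (fun h hl => H h (mem_behead (s := g :: l) hl)).
have [b' [sb' eb']] := mask_toggle (H g (mem_head _ _)) sb.
by exists b'; split=> //; rewrite big_cons eb' eb.
Qed.

Lemma spanned_mask r (f : Pk k) : spanned (fun g => g \in r) f ->
  exists b : bitseq, hit (f + \sum_(g <- mask b r) g).
Proof.
by move=> [l [lr hl]]; have [b [_ eb]] := mask_sum lr; exists b; rewrite -eb.
Qed.

Lemma qdim_spanN (V : Pk k -> Prop) : (exists N, spanN V N) -> spanN V (qdim V).
Proof.
move=> h; rewrite /qdim; case: excluded_middle_informative => // h'.
by case: ex_minnP => N /decPP.
Qed.

Lemma qdim_min (V : Pk k -> Prop) N : spanN V N -> (qdim V <= N)%N.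
Proof.
move=> h; rewrite /qdim; case: excluded_middle_informative => // h'.
by case: ex_minnP => M _; apply; apply/decPP.
Qed.

Lemma homogn_spanN m : exists N, spanN (homogn (k := k) m) N.
Proof.
pose r : seq (Pk k) := [seq 'X_[val y] | y : 'X_{1..k < m.+1}].
exists (size r), r; split=> // f hf; apply: spanned_mask.
exists [seq 'X_[y] | y <- msupp f]; rewrite big_map -mpolyE_F2 addpp; split; last exact: hit0.
move=> _ /mapP[y yf ->]; have /allP/(_ y yf)/eqP dy := hf.
have ym : (mdeg y < m.+1)%N by rewrite dy.
by apply/mapP; exists (BMultinom ym) => //; rewrite mem_enum.
Qed.

End MaskSums.

(** * Steenrod squares commute with substitution of variables *)

Section VariableSubstitution.
Variables (k k' : nat) (v : 'I_k' -> 'I_k) (lq : k'.-tuple (Pk k)).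
Hypothesis lqE : forall t, tnth lq t = 'X_(v t).

Lemma St_comp (g : Pk k') : St (comp_mpoly lq g) = map_poly (comp_mpoly lq) (St g).
Proof.
have mapX (t : 'I_k') : map_poly (comp_mpoly lq) (Stvar t) = Stvar (v t).
  rewrite /Stvar rmorphD /= map_polyC map_polyZ map_polyX /= rmorphXn /=.
  by rewrite comp_mpolyXU -tnth_nth lqE.
apply: (@mpoly_ind_supp _ (fun g => St (comp_mpoly lq g) = map_poly (comp_mpoly lq) (St g))).
- by rewrite !rmorph0.
- move=> p q ep eq; apply: (etrans (congr1 (@St k) (comp_mpolyD lq p q))).
  apply: (etrans (StD _ _)); apply: (etrans (congr2 +%R ep eq)); apply: esym.
  by apply: (etrans (congr1 _ (StD p q))); exact: rmorphD.
move=> m _; rewrite comp_mpolyX rmorph_prod [St 'X_[m]]mmapX /mmap1 rmorph_prod.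
by apply: eq_bigr => t _; rewrite !rmorphXn /= lqE StX mapX.
Qed.

Lemma Sq_comp a (g : Pk k') : Sq a (comp_mpoly lq g) = comp_mpoly lq (Sq a g).
Proof. by rewrite !SqE St_comp coef_map. Qed.

Lemma dhomog_comp D (g : Pk k') : g \is D.-homog -> comp_mpoly lq g \is D.-homog.
Proof.
move=> hg; rewrite [g]mpolyE_F2 raddf_sum big_seq; apply: rpred_sum => m mg /=.
have <- : mdeg m = D by apply: (dhomog_mf hg).
rewrite comp_mpolyX mdegE; apply: (big_ind2 (fun (p : Pk k) n => p \is n.-homog)).
- exact: dhomog1.
- by move=> p n q n'; apply: dhomogM.
- by move=> t _; rewrite lqE -[X in X.-homog]mul1n; apply: dhomogMn; apply: dhomog_var.
Qed.

Lemma hitn_comp D (g : Pk k') : hitn D g -> hitn D (comp_mpoly lq g).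
Proof.
move=> [d [l [hl -> _]]]; rewrite raddf_sum; apply: hitn_sum => -[a h] /hl[a0 [e eD hh]] _ /=.
by rewrite -Sq_comp; apply: (hitn_Sq a0 _ eD); apply: dhomog_comp.
Qed.

End VariableSubstitution.

Lemma fij_var k (i j : 'I_k) : i != j -> exists v : 'I_(k - 2) -> 'I_k, forall t,
  tnth [tuple nth 0 [seq ('X_l : Pk k) | l <- enum [pred l : 'I_k | (l != i :> nat) && (l != j :> nat)]] t
    | t < k - 2] t = 'X_(v t).
Proof.
move=> ij; set E := enum _; exists (fun t => nth i E t) => t.
have sE : size E = (k - 2)%N by apply: size_enum_neq2.
by rewrite tnth_mktuple (nth_map i) // sE ltn_ord.
Qed.

(** * Generators of the kernel and the dimension bound *)

Section Generators.
Variables (k s M0 d0 d : nat) (B : {set pairT k d0}).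
Hypothesis base : spike_base s M0.
Hypothesis ks : k = s.+2.
Hypothesis sM : (s <= M0)%N.
Hypothesis d02 : (2 < d0)%N.
Hypothesis d0d : (d0 <= d)%N.
Hypothesis Binc : forall p, p \in B -> inPInc p.
Hypothesis Bcomp : compatible B.
Implicit Types (p : pairT k d0) (q : Pk (k - 2)).

(** The extension of [gen] from monomials to polynomials, additive because [2 ^ d]-th powers are. *)
Definition genpoly p q : Pk k :=
  XIJ p * Xij k (tmin p.1) (tmin p.2) ^+ (2 ^ d - 2 ^ d0) *
  fij (k := k) (tmin p.1) (tmin p.2) q ^+ (2 ^ d).

Lemma genpolyD p q q' : genpoly p (q + q') = genpoly p q + genpoly p q'.
Proof. by rewrite /genpoly /fij raddfD /= expp2XnD mulrDr. Qed.

Lemma genpoly0 p : genpoly p 0 = 0.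
Proof. by rewrite /genpoly /fij raddf0 expr0n expn_eq0 /= mulr0. Qed.

Lemma genpoly_sum p (I : Type) (r : seq I) (F : I -> Pk (k - 2)) :
  genpoly p (\sum_(i <- r) F i) = \sum_(i <- r) genpoly p (F i).
Proof. exact: (big_morph _ (genpolyD p) (genpoly0 p)). Qed.

(** The substitution preserves hits, and so does building a tower on top. Hence the class of a
    generator depends only on the class of [q]. *)
Lemma genpoly_hit p q : p \in B -> q \is (deg s M0 0).-homog -> hit q -> hit (genpoly p q).
Proof.
move=> pB hq hitq; have wc := wf_tmin ks d02 Binc Bcomp pB.
have [i [j [ij [e1 e2] _]]] := wfpair_ord wc.
have hf : hitn (deg s M0 0) (fij (k := k) (tmin p.1) (tmin p.2) q).
  have [v vE] := fij_var ij.
  by rewrite e1 e2; apply: (hitn_comp vE); apply: hit_hitn.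
have -> : genpoly p q = XT (nseq (d - d0) (tmin p.1, tmin p.2) ++ zipp p)
                           (fij (k := k) (tmin p.1) (tmin p.2) q).
  by rewrite (gen_XT ks) subnK.
apply: hitn_hit; apply: (hitn_XT base ks sM _ hf).
by rewrite all_cat (wf_zippB ks Binc pB) andbT; apply/allP => x /nseqP[-> _].
Qed.

Lemma kernel_spanned f : kerKameko (k := k) (deg s M0 d) f -> spanned (genp s M0 B d) f.
Proof.
move=> [hf hk]; have d1 : d = d.-1.+1 by lia.
have hf' : f \is (deg s M0 d.-1.+1).-homog by rewrite -d1.
have := kernel_tower base ks sM hf' hk; rewrite -d1.
apply: spanned_trans => g; exact: tower_gen.
Qed.

Lemma kernel_admissible f : kerKameko (k := k) (deg s M0 d) f ->
  exists l : seq (pairT k d0 * 'X_{1..(k - 2)%N}),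
    (forall x, x \in l -> [/\ x.1 \in B, mdeg x.2 = deg s M0 0 & admissible x.2]) /\
    hit (f + \sum_(x <- l) gen d x.1 x.2).
Proof.
move=> /kernel_spanned[l0 [Gl0 hl0]].
suff [l [Hl hl]] : exists l : seq (pairT k d0 * 'X_{1..(k - 2)%N}),
    (forall x, x \in l -> [/\ x.1 \in B, mdeg x.2 = deg s M0 0 & admissible x.2]) /\
    hit (\sum_(g <- l0) g + \sum_(x <- l) gen d x.1 x.2).
  exists l; split=> //; rewrite -(addppK f (\sum_(g <- l0) g)) -addrA; exact: hitD.
elim: l0 Gl0 {hl0} => [|g l0 IH] Gl0.
  by exists [::]; rewrite !big_nil addr0; split=> //; apply: hit0.
have [l [Hl hl]] := IH (fun h hl => Gl0 h (mem_behead (s := g :: l0) hl)).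
have [p [y [pB dy ->]]] := Gl0 g (mem_head _ _).
have [ys [Hys hys]] := admissible_span y.
exists ([seq (p, y') | y' <- ys] ++ l); split.
  move=> x; rewrite mem_cat => /orP[/mapP[y' /Hys[dy' ady'] ->]|/Hl //].
  by split=> //=; rewrite dy' dy.
rewrite big_cons big_cat /= addrACA big_map; apply: hitD => //.
have -> : gen d p y + \sum_(y' <- ys) gen d p y' =
          genpoly p ('X_[y] + \sum_(y' <- ys) 'X_[y']).
  by rewrite genpolyD genpoly_sum.
apply: genpoly_hit => //; apply: rpredD; first by rewrite dhomogX; apply/eqP.
rewrite big_seq; apply: rpred_sum => y' /Hys[dy' _].
by rewrite dhomogX; apply/eqP; apply: etrans dy' dy.
Qed.

Lemma kernel_qdim :
  (qdim (kerKameko (k := k) (deg s M0 d)) <=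
     #|B| * qdim (homogn (k := (k - 2)%N) (deg s M0 0)))%N.
Proof.
have [r0 [sr0 Hr0]] := qdim_spanN (@homogn_spanN (k - 2) (deg s M0 0)).
(* A family in [spanN] need not be homogeneous, so it is projected onto the degree first. *)
pose r1 := [seq pihomog mdeg (deg s M0 0) g | g <- r0].
pose r := [seq genpoly p g | p <- enum B, g <- r1].
apply: qdim_min; exists r; split.
  by rewrite size_allpairs size_map sr0 -cardE.
move=> f /kernel_spanned hf; apply: spanned_mask.
apply: spanned_trans hf => _ [p [y [pB dy ->]]].
have hX : ('X_[y] : Pk (k - 2)) \is (deg s M0 0).-homog by rewrite dhomogX; apply/eqP.
have [b hb] := Hr0 'X_[y] hX.
have := hit_pihomog (deg s M0 0) hb; rewrite raddfD raddf_sum /= (pihomog_dE hX) => h.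
exists [seq genpoly p g | g <- mask b r1]; split.
  move=> _ /mapP[g /mem_mask gr ->]; apply: allpairs_f => //; by rewrite mem_enum.
rewrite big_map -[gen _ _ _]/(genpoly p 'X_[y]) -genpoly_sum -genpolyD.
rewrite /r1 -map_mask big_map; apply: genpoly_hit => //.
apply: rpredD => //; apply: rpred_sum => g _; exact: pihomogP.
Qed.

End Generators.

(** * Matching the degrees of the theorem with [deg] *)

Theorem theorem3 (k d0 : nat) (ds : nat -> nat) (n m : nat)
  (B : {set pairT k d0}) :
  (4 <= k)%N -> (2 < d0)%N ->
  (forall i, (1 <= i <= k - 2)%N -> (0 < ds i)%N) ->
  (forall i, (1 <= i)%N -> (i < k - 3)%N -> (ds i.+1 < ds i)%N) ->
  (ds (k - 2) <= ds (k - 3))%N ->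
  (d0 <= ds (k - 2))%N ->
  n = (\sum_(1 <= i < k - 1) (2 ^ ds i - 1))%N ->
  m = (\sum_(1 <= i < k - 2) (2 ^ (ds i - ds (k - 2)) - 1))%N ->
  (forall p, p \in B -> inPInc p) ->
  compatible B ->
  (forall f : Pk k, kerKameko n f ->
     exists l : seq (pairT k d0 * 'X_{1..(k - 2)%N}),
       (forall x, x \in l -> [/\ x.1 \in B, mdeg x.2 = m & admissible x.2]) /\
       hit (f + \sum_(x <- l) gen (ds (k - 2)%N) x.1 x.2)) /\
  (qdim (kerKameko (k:=k) n) <= #|B| * qdim (homogn (k:=(k - 2)%N) m))%N.
Proof.
move=> k4 d02 _ dec decs d0d en em Binc Bcomp.
have [s ks] : exists s, k = s.+2 by exists (k - 2)%N; lia.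
have s1 : (1 < s)%N by lia.
have k2 : (k - 2 = s)%N by lia.
have k3 : (k - 3 = s.-1)%N by lia.
have k1 : (k - 1 = s.+1)%N by lia.
rewrite k2 in decs d0d em; rewrite k3 in dec decs; rewrite k1 in en.
rewrite [X in gen (ds X)]k2 {k1 k3}; set d := ds s in decs d0d em *.
have le_d i : (1 <= i <= s)%N -> (d <= ds i)%N.
  move=> /andP[i1 le_is]; have [->//|i_s] := eqVneq i s.
  have : (i <= s.-1)%N by lia.
  move=> /subnK; move: (s.-1 - i)%N => t; elim: t i i1 {le_is i_s} => [|t IH] i i1 e.
    by rewrite (_ : i = s.-1) //; lia.
  have := IH i.+1 isT ltac:(lia); have := dec i i1 ltac:(lia); lia.
pose M0 := (\sum_(1 <= i < s.+1) 2 ^ (ds i - d))%N.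
have base : spike_base s M0.
  apply: spike_baseP => // [i i1 lt_i|].
    by have := dec i i1 lt_i; have := le_d i.+1 ltac:(lia); lia.
  by rewrite leq_sub2r.
have sum1 (F : nat -> nat) : (forall i, (1 <= i <= s)%N -> (0 < F i)%N) ->
    (\sum_(1 <= i < s.+1) (F i - 1) + s = \sum_(1 <= i < s.+1) F i)%N.
  move=> F0; have Es : (\sum_(1 <= i < s.+1) 1 = s)%N by rewrite sum_nat_const_nat; lia.
  rewrite -[X in (_ + X)%N]Es -big_split; apply: eq_big_nat => i /andP[i1 i_s].
  by rewrite /= subnK // F0 // i1.
have pow i : (0 < 2 ^ i)%N by rewrite expn_gt0.
have M0E : (m + s = M0)%N.
  (* The sum for [M0] has one term more than the sum for [m]; at [i = s] it contributes
     [2 ^ 0 - 1 = 0]. *)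
  rewrite /M0 -sum1 // em big_nat_recr /=; last by lia.
  by rewrite subnn addn0.
have sM : (s <= M0)%N by rewrite -M0E leq_addl.
have em0 : m = deg s M0 0 by rewrite /deg mul1n -M0E addnK.
have end_ : n = deg s M0 d.
  have : (n + s = 2 ^ d * M0)%N.
    rewrite en sum1 // /M0 big_distrr; apply: eq_big_nat => i /andP[i1 i_s].
    by rewrite /= -expnD subnKC // le_d // i1.
  by rewrite /deg => <-; rewrite addnK.
rewrite em0 end_; split; last exact: kernel_qdim.
by move=> f; apply: kernel_admissible.
Qed.
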